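(* Let $n\ge 3$, $a>0$, and let $f\in C_c^\infty(\mathbb{R}^n)$ with $\operatorname{supp} f\subset B(0,a)$. For $s\ge 0$ and $r>s$ define $$g(s,r)=|\mathbb{S}^{n-3}|\,\frac{(r^2-s^2)^{(n-4)/2}}{r^{n-3}}.$$ Then for all $v\in\mathbb{S}^{n-1}$, $p\in\mathbb{S}_a^{n-1}$ and $s\ge 0$, $$\int_s^\infty Cf(v,p,r)\,g(s,r)\,dr=\int_{\mathbb{S}^{n-1}}Rf(\sigma,s+\sigma\cdot p)\,\delta(\sigma\cdot v)\,d\sigma=F(R_sT_pf)(v).$$
   Context: Notation: $\mathbb{S}^{n-1}$ is the unit sphere in $\mathbb{R}^n$; $|\mathbb{S}^{k}|$ is the $k$-dimensional surface measure of $\mathbb{S}^k$ (with $|\mathbb{S}^0|=2$); $B(0,a)$ is the ball of radius $a$ centered at the origin, and $\mathbb{S}_a^{n-1}$ the sphere of radius $a$ centered at the origin. $T_pf(x)=f(x+p)$. Cylindrical Radon transform: for $v\in\mathbb{S}^{n-1}$, $p\in\mathbb{S}_a^{n-1}$, $r>0$, let $\mathscr{C}(v,p,r)=\{y\in\mathbb{R}^n: |y-p|^2-[v\cdot(y-p)]^2=r^2\}$ be the cylinder of radius $r$ around the line through $p$ in direction $v$, and $Cf(v,p,r)=\int_{\mathscr{C}(v,p,r)}f(y)\,dS(y)$, with $dS$ the $(n-1)$-dimensional surface measure. Radon transform: $Rf(\omega,s)=\int_{x\cdot\omega=s}f(x)\,dx$ for $\omega\in\mathbb{S}^{n-1}$,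 $s\in\mathbb{R}$ (integration against $(n-1)$-dimensional Lebesgue measure on the hyperplane). For fixed $s$, $R_sf(\omega):=Rf(\omega,s)$, a function on $\mathbb{S}^{n-1}$. Funk transform: for $u\in C^\infty(\mathbb{S}^{n-1})$, $Fu(v)=\int_{\mathbb{S}^{n-1}}u(\sigma)\,\delta(\sigma\cdot v)\,d\sigma$, where the right-hand side means the integral of $u$ over the great subsphere $\{\sigma\in\mathbb{S}^{n-1}:\sigma\cdot v=0\}$ with respect to its $(n-2)$-dimensional surface measure (counting-type measure conventions are not needed since $n\ge3$). *)

(* Defs.v *)
From HB Require Import structures.
From mathcomp Require Import all_boot all_order all_algebra.
From mathcomp Require Import all_classical all_reals all_analysis.
From mathcomp Require Import measurable_realfun.
From mathcomp Require Import ring lra.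

Set Implicit Arguments.
Unset Strict Implicit.
Unset Printing Implicit Defensive.

Import Order.TTheory GRing.Theory Num.Theory.
Import numFieldNormedType.Exports.

Local Open Scope classical_set_scope.
Local Open Scope ring_scope.

(* The library norm of 'rV[R]_n is the sup norm, hence a separate Euclidean
   norm; both norms induce the same topology. *)
Definition dot (R : realType) (n : nat) (u v : 'rV[R]_n) : R :=
  (u *m v^T) ord0 ord0.

Definition norm2 (R : realType) (n : nat) (u : 'rV[R]_n) : R :=
  Num.sqrt (dot u u).

Lemma dotE (R : realType) (n : nat) (u v : 'rV[R]_n) :
  dot u v = \sum_i u ord0 i * v ord0 i.
Proof. by rewrite /dot mxE; apply: eq_bigr => i _; rewrite mxE. Qed.

Section partial.
Variables (R : realType) (n : nat).

Fixpoint iter_partial (s : seq 'I_n) (f : 'rV[R]_n -> R) : 'rV[R]_n -> R :=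
  if s is i :: s' then
    fun x => derive (iter_partial s' f) x (delta_mx ord0 i)
  else f.

Definition smooth (f : 'rV[R]_n -> R) : Prop :=
  forall s : seq 'I_n,
    continuous (iter_partial s f) /\
    forall (i : 'I_n) (x : 'rV[R]_n),
      derivable (iter_partial s f) x (delta_mx ord0 i).

Definition supp (f : 'rV[R]_n -> R) : set 'rV[R]_n :=
  closure [set x | f x != 0].

Definition Cc_infty (f : 'rV[R]_n -> R) : Prop := smooth f /\ compact (supp f).

Definition eball (a : R) : set 'rV[R]_n := [set x | norm2 x < a].

Definition esphere (a : R) : set 'rV[R]_n := [set x | norm2 x = a].

End partial.
Arguments eball {R} n a.
Arguments esphere {R} n a.

Definition rV_display : measure_display.
Proof. exact: (measure_tuple_display default_measure_display). Qed.

(* The Borel sigma-algebra of R^n, generated by the coordinates. *)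
Section rV_measurable.
Variables (R : realType) (n : nat).

Let coors : 'I_n -> 'rV[R]_n -> R := fun i x => x ord0 i.

Let rV_set0 : g_sigma_preimage coors set0.
Proof. exact: sigma_algebra0. Qed.

Let rV_setC A : g_sigma_preimage coors A -> g_sigma_preimage coors (~` A).
Proof. exact: sigma_algebraC. Qed.

Let rV_bigcup (F : _^nat) : (forall i, g_sigma_preimage coors (F i)) ->
  g_sigma_preimage coors (\bigcup_i (F i)).
Proof. exact: sigma_algebra_bigcup. Qed.

HB.instance Definition _ := @isMeasurable.Build rV_display
  'rV[R]_n (g_sigma_preimage coors) rV_set0 rV_setC rV_bigcup.

Lemma measurable_coord (i : 'I_n) :
  measurable_fun setT (fun x : 'rV[R]_n => x ord0 i : R).
Proof.
move=> _ Y mY; rewrite setTI; apply: sub_sigma_algebra => /=.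
rewrite -bigcup_seq/=; exists i => /=; first by rewrite mem_index_enum.
by exists Y => //; rewrite setTI.
Qed.

Lemma measurable_fun_rV d (T : measurableType d) (f : T -> 'rV[R]_n) :
  (forall i, measurable_fun setT (fun x => f x ord0 i : R)) ->
  measurable_fun setT f.
Proof.
move=> mf.
have : g_sigma_preimage (fun i => coors i \o f) `<=` measurable.
  apply: smallest_sub; first exact: sigma_algebra_measurable.
  rewrite -bigcup_seq => A [i _] [B mB <-].
  by rewrite setTI -[X in measurable X]setTI; exact: mf.
rewrite g_sigma_preimage_comp => H _ A mA.
by rewrite setTI; apply: H; exists A => //; rewrite setTI.
Qed.

End rV_measurable.

#[local] Notation pushforward_measure :=
  measure_function_pushforward__canonical__measure_function_Measure.

Section lebesgue_rV.
Variable R : realType.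

Definition cons_rV (k : nat) (z : R * 'rV[R]_k) : 'rV[R]_k.+1 :=
  row_mx z.1%:M z.2 : 'rV[R]_(1 + k).

Definition behead_rV (k : nat) (x : 'rV[R]_k.+1) : 'rV[R]_k :=
  rsubmx (x : 'rV[R]_(1 + k)).

Lemma measurable_cons_rV k : measurable_fun setT (@cons_rV k).
Proof.
apply: measurable_fun_rV => i.
have -> : (fun z => cons_rV z ord0 i) =
    (fun z : R * 'rV[R]_k =>
      match fintype.split (i : 'I_(1 + k)) with
      | inl _ => z.1 | inr j => z.2 ord0 j end).
  apply/funext => z; rewrite /cons_rV mxE; case: fintype.split => j //.
  by rewrite mxE (ord1 j).
case: (fintype.split (i : 'I_(1 + k))) => [_|j]; first exact: measurable_fst.
exact: (measurableT_comp (measurable_coord j) measurable_snd).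
Qed.

Lemma measurable_behead_rV k : measurable_fun setT (@behead_rV k).
Proof.
apply: measurable_fun_rV => i; under eq_fun do rewrite mxE.
exact: measurable_coord.
Qed.

Lemma cons_rVK k (z : R * 'rV[R]_k) :
  ((cons_rV z) ord0 ord0, behead_rV (cons_rV z)) = z.
Proof.
case: z => x y; congr pair; last by rewrite /behead_rV row_mxKr.
rewrite /cons_rV mxE; case: splitP => j //= _.
by rewrite mxE (ord1 j).
Qed.

Lemma behead_rVK k (x : 'rV[R]_k.+1) :
  cons_rV (x ord0 ord0, behead_rV x) = x.
Proof.
have x0E : (x ord0 ord0)%:M = lsubmx (x : 'rV[R]_(1 + k)).
  apply/rowP => i; rewrite !mxE (ord1 i) eqxx mulr1n; congr (x _ _).
  exact/val_inj.
by rewrite /cons_rV /behead_rV /= x0E; exact: (@hsubmxK R 1 1 k x).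
Qed.

Section cons_measure.
Variables (k : nat) (mu : {sigma_finite_measure set 'rV[R]_k -> \bar R}).

Definition cons_measure : set 'rV[R]_k.+1 -> \bar R :=
  pushforward (lebesgue_measure \x mu)%E (@cons_rV k).

HB.instance Definition _ := Measure.copy cons_measure
  (pushforward_measure (lebesgue_measure \x mu)%E (@measurable_cons_rV k)).

Let cons_measure_sigma_finite : sigma_finite setT cons_measure.
Proof.
have /sigma_finiteP[F [TF ndF Foo]] := sigma_finiteT (@lebesgue_measure R).
have /sigma_finiteP[G [TG ndG Goo]] := sigma_finiteT mu.
pose g := fun x : 'rV[R]_k.+1 => (x ord0 ord0, behead_rV x).
have mg : measurable_fun setT g.
  apply/measurable_fun_pair; first exact: measurable_coord.
  exact: measurable_behead_rV.
exists (fun i => g @^-1` (F i `*` G i)).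
  rewrite -preimage_bigcup -[LHS](preimage_setT g); congr (_ @^-1` _).
  rewrite -setXTT TF TG predeqE => -[x y]; split.
    move=> [/= [n _ Fnx] [m _ Gmy]]; exists (maxn n m) => //; split.
    - by move: x Fnx; exact/subsetPset/ndF/leq_maxl.
    - by move: y Gmy; exact/subsetPset/ndG/leq_maxr.
  by move=> [n _ []/= ? ?]; split; exists n.
move=> i; have [mFi Fi] := Foo i; have [mGi Gi] := Goo i; split.
  by rewrite -[X in measurable X]setTI; apply: mg => //; exact: measurableX.
rewrite /cons_measure /pushforward -comp_preimage (_ : g \o _ = id).
  by rewrite preimage_id product_measure1E// lte_mul_pinfty// ge0_fin_numE.
by apply/funext => z; exact: cons_rVK.
Qed.

HB.instance Definition _ := Measure_isSigmaFinite.Build _ _ _ cons_measure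
  cons_measure_sigma_finite.

End cons_measure.

Fixpoint lebesgue_rV (k : nat) : {sigma_finite_measure set 'rV[R]_k -> \bar R} :=
  match k with
  | 0 => dirac (0 : 'rV[R]_0)
  | k'.+1 => cons_measure (lebesgue_rV k')
  end.

End lebesgue_rV.

Section sphere_measure.
Variables (R : realType) (k : nat).

Lemma measurable_norm2 : measurable_fun setT (@norm2 R k).
Proof.
apply: measurableT_comp.
  by apply: continuous_measurable_fun; exact: sqrt_continuous.
under eq_fun do rewrite dotE.
apply: measurable_sum => i.
by apply: measurable_funM; exact: measurable_coord.
Qed.

(* The truncated cone {t x | 0 < t <= 1, x \in A, |x| = r}, for r > 0. *)
Definition cone (r : R) (A : set 'rV[R]_k) : set 'rV[R]_k :=
  [set x | A ((r / norm2 x) *: x)] `&` [set x | 0 < norm2 x <= r].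

Let radial (r : R) (x : 'rV[R]_k) : 'rV[R]_k := (r / norm2 x) *: x.

Let measurable_radial (r : R) : measurable_fun setT (radial r).
Proof.
apply: measurable_fun_rV => i; under eq_fun do rewrite mxE.
apply: measurable_funM; last exact: measurable_coord.
apply: measurable_funM; first exact: measurable_cst.
have -> : (fun x : 'rV[R]_k => (norm2 x)^-1) =
    (@powR R ^~ (-1)) \o @norm2 R k.
  by apply/funext => x /=; rewrite powR_inv1// sqrtr_ge0.
apply: measurableT_comp measurable_norm2.
exact: measurable_powR.
Qed.

Let measurable_punctured_ball (r : R) :
  measurable [set x : 'rV[R]_k | 0 < norm2 x <= r].
Proof.
have -> : [set x : 'rV[R]_k | 0 < norm2 x <= r] =
    setT `&` @norm2 R k @^-1` `]0, r].
  by rewrite setTI; apply/seteqP; split=> x; rewrite /= in_itv.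
exact: measurable_norm2.
Qed.

(* The (k-1)-dimensional surface measure of the sphere of radius r > 0 centred
   at the origin of R^k: a cone with vertex 0 over a piece A of that sphere has
   volume (r / k) * area A. *)
Definition sphere_measure (r : R) : set 'rV[R]_k -> \bar R :=
  fun A => ((k%:R / `|r|)%:E * lebesgue_rV R k (cone r A))%E.

HB.instance Definition _ (r : R) := Measure.copy (sphere_measure r)
  (mscale (k%:R / `|r|)%:nng
    (pushforward_measure
      (mrestr (lebesgue_rV R k) (measurable_punctured_ball r))
      (measurable_radial r))).

End sphere_measure.

(* |S^k|, the surface measure of the unit sphere of R^(k+1). *)
Definition sphere_area (R : realType) (k : nat) : R :=
  fine (sphere_measure (1 : R) [set: 'rV[R]_k.+1]).

Section frame.
Variables (R : realType) (n : nat).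

(* The rows of E form an orthonormal basis of the hyperplane orthogonal to v. *)
Definition is_perp_frame (v : 'rV[R]_n) (E : 'M[R]_(n.-1, n)) : Prop :=
  E *m E^T = 1%:M /\ E *m v^T = 0.

(* The measures below are pushforwards of rotation-invariant measures along
   y |-> y *m perp_frame v, so they do not depend on the chosen frame. *)
Definition perp_frame (v : 'rV[R]_n) : 'M[R]_(n.-1, n) :=
  xget 0 [set E | is_perp_frame v E].

(* Rows 1, ..., n-1 of the Householder reflection that exchanges v and the
   first basis vector. *)
Lemma perp_frame_exists (v : 'rV[R]_n) :
  norm2 v = 1 -> exists E, is_perp_frame v E.
Proof.
rewrite /is_perp_frame; case: n v => [|m] v v1 /=.
  by exfalso; move: v1; rewrite /norm2 dotE big_ord0 sqrtr0 => /esym/eqP;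
    rewrite oner_eq0.
have vv : v *m v^T = 1%:M.
  rewrite [LHS]mx11_scalar; congr _%:M; rewrite -/(dot v v).
  have v0 : 0 <= dot v v.
    by rewrite dotE; apply: sumr_ge0 => i _; rewrite -expr2 sqr_ge0.
  by rewrite -[LHS]sqr_sqrtr// -/(norm2 v) v1 expr1n.
pose e : 'rV[R]_m.+1 := delta_mx ord0 ord0.
pose a := v ord0 ord0.
have ee : e *m e^T = 1%:M.
  by rewrite trmx_delta mul_delta_mx; apply/matrixP => i j;
    rewrite !mxE (ord1 i) (ord1 j).
have ev : e *m v^T = a%:M.
  by rewrite [LHS]mx11_scalar -rowE !mxE.
have ve : v *m e^T = a%:M.
  by rewrite -[LHS]trmxK trmx_mul trmxK ev tr_scalar_mx.
pose u := v - e; pose b := 2 - 2 * a; pose c := 2 / b.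
have uu : u *m u^T = b%:M.
  rewrite /u linearB /= mulmxBl !mulmxBr vv ee ev ve.
  by rewrite -!raddfB /=; congr _%:M; rewrite /b; ring.
have u0 : b = 0 -> u = 0.
  move=> b0; move: uu; rewrite b0 => /(congr1 (fun M : 'M[R]_1 => M ord0 ord0)).
  rewrite -/(dot u u) dotE mxE mul0rn => /eqP.
  rewrite psumr_eq0 => [/allP uu0|i _]; last by rewrite -expr2 sqr_ge0.
  apply/rowP => i; rewrite [RHS]mxE; apply/eqP.
  by have := uu0 i (mem_index_enum i); rewrite /= mulf_eq0 orbb.
have eu : e *m u^T = (a - 1)%:M.
  by rewrite /u linearB /= mulmxBr ev ee -raddfB.
have uE : u = v - e by [].
move: u uE uu u0 eu => u uE uu u0 eu.
pose H : 'M[R]_m.+1 := 1%:M - c *: (u^T *m u).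
have HT : H^T = H.
  by rewrite /H linearB /= linearZ /= trmx_mul trmxK trmx1.
have HH : H *m H = 1%:M.
  have P2 : (u^T *m u) *m (u^T *m u) = b *: (u^T *m u).
    by rewrite mulmxA -(mulmxA _ u) uu mul_mx_scalar -scalemxAl.
  rewrite /H mulmxBl !mulmxBr !mul1mx mulmx1 -scalemxAl -scalemxAr P2 !scalerA.
  have -> : c * c * b = c + c.
    rewrite /c; have [->|b0] := eqVneq b 0; first by rewrite invr0 !mulr0 addr0.
    by field.
  by rewrite scalerDl opprB addrK subrK.
have eH : e *m H = v.
  rewrite /H mulmxBr mulmx1 -scalemxAr mulmxA eu mul_scalar_mx scalerA.
  have [b0|b0] := eqVneq b 0.
    by rewrite (u0 b0) scaler0 subr0; apply/esym/eqP; rewrite -subr_eq0 -uE u0.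
  have -> : c * (a - 1) = -1 by rewrite /c; move: b0; rewrite /b => b0; field.
  by rewrite scaleN1r opprK uE addrC subrK.
exists (rowsub (lift ord0) H); split.
  apply/matrixP => i j.
  have := congr1 (fun M : 'M[R]_m.+1 => M (lift ord0 i) (lift ord0 j)) HH.
  rewrite -{2}HT !mxE (inj_eq lift_inj) => <-.
  by apply: eq_bigr => l _; rewrite !mxE.
rewrite -eH trmx_mul HT mulmxA mul_rowsub_mx HH.
apply/matrixP => i j; rewrite !mxE big1// => l _; rewrite !mxE (ord1 j) eqxx /=.
have [->|l0] := eqVneq l ord0; last by rewrite mulr0.
by rewrite eq_sym -[_ == _]negbK neq_lift mul0r.
Qed.

Lemma perp_frameP (v : 'rV[R]_n) :
  norm2 v = 1 -> is_perp_frame v (perp_frame v).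
Proof. by move=> /perp_frame_exists; exact: xgetPex. Qed.

Lemma measurable_mulmx_rV d (T : measurableType d) (m : nat)
    (M : 'M[R]_(m, n)) (g : T -> 'rV[R]_m) :
  measurable_fun setT g -> measurable_fun setT (fun x => g x *m M).
Proof.
move=> mg; apply: measurable_fun_rV => i; under eq_fun do rewrite mxE.
apply: measurable_sum => j; apply: measurable_funM; last exact: measurable_cst.
exact: (measurableT_comp (measurable_coord j) mg).
Qed.

Lemma measurable_addrV d (T : measurableType d) (g h : T -> 'rV[R]_n) :
  measurable_fun setT g -> measurable_fun setT h ->
  measurable_fun setT (fun x => g x + h x).
Proof.
move=> mg mh; apply: measurable_fun_rV => i; under eq_fun do rewrite mxE.
by apply: measurable_funD;
  [exact: (measurableT_comp (measurable_coord i) mg)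
  |exact: (measurableT_comp (measurable_coord i) mh)].
Qed.

Lemma measurable_scalerV d (T : measurableType d) (h : T -> R) (w : 'rV[R]_n) :
  measurable_fun setT h -> measurable_fun setT (fun x => h x *: w).
Proof.
move=> mh; apply: measurable_fun_rV => i; under eq_fun do rewrite mxE.
by apply: measurable_funM => //; exact: measurable_cst.
Qed.

End frame.

Section transforms.
Variables (R : realType) (n : nat).
Implicit Types (f u : 'rV[R]_n -> R) (v w p : 'rV[R]_n) (r s : R).

Definition hyperplane w s : set 'rV[R]_n := [set x | dot x w = s].

(* (n-1)-dimensional Lebesgue measure on hyperplane w s, for a unit vector w. *)
Definition hyperplane_measure w s : set 'rV[R]_n -> \bar R :=
  pushforward (lebesgue_rV R n.-1) (fun y => s *: w + y *m perp_frame w).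

Let measurable_hyperplane w s :
  measurable_fun setT (fun y : 'rV[R]_n.-1 => s *: w + y *m perp_frame w).
Proof.
apply: measurable_addrV; first exact: measurable_cst.
by apply: measurable_mulmx_rV; exact: measurable_id.
Qed.

HB.instance Definition _ w s := Measure.copy (hyperplane_measure w s)
  (pushforward_measure (lebesgue_rV R n.-1) (measurable_hyperplane w s)).

Definition Radon f w s : R :=
  (\int[hyperplane_measure w s]_(x in hyperplane w s) f x)%R.

Definition cylinder v p r : set 'rV[R]_n :=
  [set y | norm2 (y - p) ^+ 2 - dot v (y - p) ^+ 2 = r ^+ 2].

(* (n-1)-dimensional surface measure on cylinder v p r, for a unit vector v and
   r > 0: the cylinder is the orthogonal product of the axis p + R v and of the
   (n-2)-sphere of radius r in the hyperplane orthogonal to v. *)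
Definition cylinder_measure v p r : set 'rV[R]_n -> \bar R :=
  pushforward (@sphere_measure R n.-1 r \x lebesgue_measure)%E
    (fun z => p + z.2 *: v + z.1 *m perp_frame v).

Let measurable_cylinder v p :
  measurable_fun setT
    (fun z : 'rV[R]_n.-1 * R => p + z.2 *: v + z.1 *m perp_frame v).
Proof.
apply: measurable_addrV.
  apply: measurable_addrV; first exact: measurable_cst.
  by apply: measurable_scalerV; exact: measurable_snd.
by apply: measurable_mulmx_rV; exact: measurable_fst.
Qed.

HB.instance Definition _ v p r := Measure.copy (cylinder_measure v p r)
  (pushforward_measure (@sphere_measure R n.-1 r \x lebesgue_measure)%E
    (measurable_cylinder v p)).

Definition cylindrical_Radon f v p r : R :=
  (\int[cylinder_measure v p r]_(y in cylinder v p r) f y)%R.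

Definition great_subsphere v : set 'rV[R]_n :=
  [set x | norm2 x = 1 /\ dot x v = 0].

(* (n-2)-dimensional surface measure on great_subsphere v, for a unit vector v:
   it is the unit sphere of the hyperplane orthogonal to v. *)
Definition great_subsphere_measure v : set 'rV[R]_n -> \bar R :=
  pushforward (@sphere_measure R n.-1 1) (fun y => y *m perp_frame v).

Let measurable_great_subsphere v :
  measurable_fun setT (fun y : 'rV[R]_n.-1 => y *m perp_frame v).
Proof. by apply: measurable_mulmx_rV; exact: measurable_id. Qed.

HB.instance Definition _ v := Measure.copy (great_subsphere_measure v)
  (pushforward_measure (@sphere_measure R n.-1 1) (measurable_great_subsphere v)).

(* The integral of u(x) delta(x . v) over x in the unit sphere. *)
Definition sphere_delta_integral u v : R :=
  (\int[great_subsphere_measure v]_(x in great_subsphere v) u x)%R.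

Definition Funk u v : R := sphere_delta_integral u v.

Definition translate p f : 'rV[R]_n -> R := fun x => f (x + p).

Definition Radon_at s f : 'rV[R]_n -> R := fun w => Radon f w s.

End transforms.

(* g(s, r) for r > s >= 0 and n >= 3 *)
Definition kernel_g (R : realType) (n : nat) (s r : R) : R :=
  sphere_area R (n - 3) *
  ((r ^+ 2 - s ^+ 2) `^ ((n%:R - 4) / 2) / r ^+ (n - 3)).

(* Main.v *)
(* Put u := f(. + p), split u into positive and negative parts so that Tonelli's
   theorem applies throughout, and let Phi(s) be the right-hand side.  For a
   test function phi >= 0, the integral of phi(s) Phi(s) ds is the integral over
   the unit vectors x orthogonal to v of \int_{R^n} phi(y . x) u(y) dy.
   Integrating u along v first, then using the rotation invariance of the sphere
   measure and polar coordinates (twice) in the hyperplane orthogonal to v, this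
   becomes the integral of phi(s) Psi(s) ds, where
   Psi(s) = \int_{R^(n-2)} A(|(s, z)|) dz and r^(n-2) A(r) is the integral of u
   over the cylinder of radius r.  Since u is dominated by a Gaussian, Phi and
   Psi are continuous, hence equal.  Finally, polar coordinates in R^(n-2) and
   the substitution r^2 = s^2 + rho^2 turn Psi(s) into the left-hand side. *)
Require Import Defs.
From HB Require Import structures.
From mathcomp Require Import all_boot all_order all_algebra.
From mathcomp Require Import all_classical all_reals all_analysis.
From mathcomp Require Import measurable_realfun ring lra.

Set Implicit Arguments.
Unset Strict Implicit.
Unset Printing Implicit Defensive.

Import Order.TTheory GRing.Theory Num.Theory.
Import numFieldNormedType.Exports.

Local Open Scope classical_set_scope.
Local Open Scope ring_scope.

(** At a fixed s the right-hand side only sees hyperplanes, which are null sets, so no change of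
    variables in R^n applies to it directly. Integrating against a function of s sweeps each family
    of parallel hyperplanes through R^n and produces a volume integral; continuity in s is the price
    for returning from averages to a single s.

    The kernel is the Jacobian of the last substitution. Polar coordinates in R^(n-2) give |S^(n-3)|
    rho^(n-3) d rho, and rho d rho = r dr turns this into |S^(n-3)| (r^2 - s^2)^((n-4)/2) r dr. The
    cylinder integral being r^(n-2) A(r), a factor r^(-(n-2)) is left over, and together with r it
    makes r^(-(n-3)). The condition n >= 3 makes R^(n-2) at least a line; for n = 3 it is a line,
    S^0 has two points, and the kernel blows up at r = s.

    Sphere measures are defined by volumes of cones, so each fact about them is read off a fact
    about Lebesgue measure. *)

#[local] Notation pushforward_measure :=
  measure_function_pushforward__canonical__measure_function_Measure.

(** * Lebesgue measure on the line and on row vectors *)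

Section lebesgue_line.
Local Open Scope ereal_scope.
Context {R : realType}.
Local Notation mu := (@lebesgue_measure R).

(** Half-open intervals determine Lebesgue measure, so it is enough to compare lengths;
    [lebesgue_scale] rests on the same principle. *)
Let lebesgue_shift (c : R) (A : set R) : measurable A ->
  pushforward mu (+%R^~ c : _ -> measurableTypeR R) A = mu A.
Proof.
have mf : measurable_fun setT (+%R^~ c : measurableTypeR R ->
  measurableTypeR R).
  by apply: measurable_funD.
move=> mA; apply/esym; apply: (@lebesgue_measure_unique _ (pushforward_measure
  mu mf)) => //= _ [[a b]] _ <-.
rewrite /pushforward /=.
have -> : (+%R^~ c : R -> R) @^-1` `]a, b] = `](a - c)%R, (b - c)%R]%classic.
  by apply/seteqP; split => x /=; rewrite !in_itv/= ltrBlDr lerBrDr.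
by rewrite !lebesgue_measure_itv/= !lte_fin ltrBDr subrK // -!EFinB;
  congr (if _ then _%:E else _); ring.
Qed.

Lemma ge0_integral_shift (c : R) (f : R -> \bar R) :
  measurable_fun setT f -> (forall x, 0 <= f x) ->
  \int[mu]_x f (x + c)%R = \int[mu]_x f x.
Proof.
move=> mf f0.
have mc : measurable_fun setT (+%R^~ c : measurableTypeR R ->
  measurableTypeR R).
  by apply: measurable_funD.
have := ge0_integral_pushforward mc mu measurableT mf (fun y _ => f0 y).
rewrite preimage_setT /comp => <-.
by apply: eq_measure_integral => //= A mA _; exact: lebesgue_shift.
Qed.

Let lebesgue_scale (c : R) (c0 : (0 < c)%R) (A : set R) : measurable A ->
  c%:E * pushforward mu ( *%R c : _ -> measurableTypeR R) A = mu A.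
Proof.
have mf : measurable_fun setT ( *%R c : measurableTypeR R -> measurableTypeR R).
  by apply: measurable_funM.
move=> mA; apply/esym.
pose c' : {nonneg R} := NngNum (ltW c0).
apply: (@lebesgue_measure_unique _ (mscale c' (pushforward_measure mu mf))) =>
  //= _ [[a b]] _ <-.
rewrite /mscale/= /pushforward /=.
have -> : ( *%R c : R -> R) @^-1` `]a, b] = `](a / c)%R, (b / c)%R]%classic.
  by apply/seteqP; split => x /=; rewrite !in_itv/= ltr_pdivrMr// ler_pdivlMr//
    ![(_ * c)%R]mulrC.
rewrite !lebesgue_measure_itv/= !lte_fin ltr_pM2r ?invr_gt0//.
case: ifPn => _; rewrite ?mule0// -!EFinB -EFinM; congr EFin.
by field; rewrite gt_eqF.
Qed.

Lemma ge0_integral_scale (c : R) (f : R -> \bar R) : (0 < c)%R ->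
  measurable_fun setT f -> (forall x, 0 <= f x) ->
  c%:E * \int[mu]_x f (c * x)%R = \int[mu]_x f x.
Proof.
move=> c0 mf f0.
have mc : measurable_fun setT ( *%R c : measurableTypeR R -> measurableTypeR R).
  by apply: measurable_funM.
pose c' : {nonneg R} := NngNum (ltW c0).
have := ge0_integral_pushforward mc mu measurableT mf (fun y _ => f0 y).
rewrite preimage_setT /comp => <-.
rewrite -[c]/(c'%:num)%R -(ge0_integral_mscale (pushforward_measure mu mc)
  measurableT c' mf)//.
by apply: eq_measure_integral => //= A mA _; exact: lebesgue_scale.
Qed.

End lebesgue_line.

Section lebesgue_rV_integral.
Local Open Scope ereal_scope.
Context {R : realType}.
Local Notation mu := (@lebesgue_measure R).

Lemma ge0_integral_rVS k (g : 'rV[R]_k.+1 -> \bar R) :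
  measurable_fun setT g -> (forall x, 0 <= g x) ->
  \int[lebesgue_rV R k.+1]_x g x =
  \int[mu]_t \int[lebesgue_rV R k]_y g (cons_rV (t, y)).
Proof.
move=> mg g0.
have mc : measurable_fun setT
    (@cons_rV R k : measurableTypeR R * 'rV[R]_k -> 'rV[R]_k.+1).
  exact: measurable_cons_rV.
have := ge0_integral_pushforward mc
  [the measure _ _ of mu \x lebesgue_rV R k] measurableT mg (fun y _ => g0 y).
rewrite preimage_setT => E; apply: (eq_trans E).
apply: (@fubini_tonelli1 _ _ _ _ _ mu (lebesgue_rV R k) (g \o @cons_rV R k)) =>
  //.
  exact: (measurableT_comp mg mc).
by move=> x /=.
Qed.

Lemma ge0_integral_rVS_swap k (g : 'rV[R]_k.+1 -> \bar R) :
  measurable_fun setT g -> (forall x, 0 <= g x) ->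
  \int[lebesgue_rV R k.+1]_x g x =
  \int[lebesgue_rV R k]_y \int[mu]_t g (cons_rV (t, y)).
Proof.
move=> mg g0; rewrite ge0_integral_rVS//.
apply: (@fubini_tonelli _ _ _ _ _ mu (lebesgue_rV R k) (g \o @cons_rV R k)).
  by apply: measurableT_comp => //; exact: measurable_cons_rV.
by move=> x /=.
Qed.

Lemma ge0_integral_rV0 (g : 'rV[R]_0 -> \bar R) :
  measurable_fun setT g -> \int[lebesgue_rV R 0]_x g x = g 0%R.
Proof. by move=> mg; rewrite integral_dirac// diracT mul1e. Qed.

Lemma cons_rVD k (x y : R * 'rV[R]_k) :
  (cons_rV x + cons_rV y = cons_rV (x.1 + y.1, x.2 + y.2))%R.
Proof.
by apply/rowP => i; rewrite !mxE; case: fintype.splitP => j _;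
  rewrite !mxE ?mulrnDl.
Qed.

Lemma cons_rVZ k (c : R) (x : R * 'rV[R]_k) :
  (c *: cons_rV x = cons_rV (c * x.1, c *: x.2))%R.
Proof.
by apply/rowP => i; rewrite !mxE; case: fintype.splitP => j _;
  rewrite !mxE ?mulrnAr.
Qed.

Lemma measurable_addl_rV k (c : 'rV[R]_k) :
  measurable_fun setT (fun x : 'rV[R]_k => (x + c)%R).
Proof. by apply: measurable_addrV; [exact: measurable_id|exact:
  measurable_cst]. Qed.

Lemma measurable_scale_rV k d (T : measurableType d) (h : T -> R) (w : T ->
  'rV[R]_k) :
  measurable_fun setT h -> measurable_fun setT w ->
  measurable_fun setT (fun x => (h x *: w x)%R).
Proof.
move=> mh mw; apply: measurable_fun_rV => i; under eq_fun do rewrite mxE.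
by apply: measurable_funM => //; exact: (measurableT_comp (measurable_coord i)
  mw).
Qed.

Lemma ge0_integral_rV_shift k (c : 'rV[R]_k) (g : 'rV[R]_k -> \bar R) :
  measurable_fun setT g -> (forall x, 0 <= g x) ->
  \int[lebesgue_rV R k]_x g (x + c)%R = \int[lebesgue_rV R k]_x g x.
Proof.
elim: k c g => [|k IH] c g mg g0.
  rewrite (ge0_integral_rV0 mg) (ge0_integral_rV0 (measurableT_comp mg
    (measurable_addl_rV c))).
  by congr g; exact: thinmx0.
have mgc : measurable_fun setT (fun z : R * 'rV[R]_k => g (cons_rV z)).
  by apply: measurableT_comp => //; exact: measurable_cons_rV.
have mgs := measurableT_comp mg (measurable_addl_rV c).
rewrite (ge0_integral_rVS mg g0) (ge0_integral_rVS mgs (fun x => g0 _)).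
rewrite -[RHS](ge0_integral_shift (c ord0 ord0)); last 2 first.
- exact: (measurable_fun_fubini_tonelli_F (fun z => g (cons_rV z))).
- by move=> x; exact: integral_ge0.
apply: eq_integral => t _.
rewrite -[RHS](IH (behead_rV c)); last 2 first.
- exact: (measurableT_comp mgc (measurable_pair1 _)).
- by move=> x.
by apply: eq_integral => y _; rewrite /= -[c in LHS]behead_rVK cons_rVD.
Qed.

Lemma ge0_integral_rV_scale k (c : R) (g : 'rV[R]_k -> \bar R) : (0 < c)%R ->
  measurable_fun setT g -> (forall x, 0 <= g x) ->
  (c ^+ k)%:E * \int[lebesgue_rV R k]_x g (c *: x)%R = \int[lebesgue_rV R k]_x
    g x.
Proof.
move=> c0; elim: k g => [|k IH] g mg g0.
  rewrite !ge0_integral_rV0// ?scaler0 ?expr0 ?mul1e//.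
  by apply: measurableT_comp => //; apply: measurable_scale_rV => //;
    exact: measurable_id.
have mgc : measurable_fun setT (fun z : R * 'rV[R]_k => g (cons_rV z)).
  by apply: measurableT_comp => //; exact: measurable_cons_rV.
have mgs : measurable_fun setT (fun x : 'rV[R]_k.+1 => g (c *: x)%R).
  by apply: measurableT_comp => //; apply: measurable_scale_rV => //;
    exact: measurable_id.
rewrite (ge0_integral_rVS mg g0) (ge0_integral_rVS mgs (fun x => g0 _)).
rewrite -[RHS](ge0_integral_scale c0); last 2 first.
- exact: (measurable_fun_fubini_tonelli_F (fun z => g (cons_rV z))).
- by move=> x; exact: integral_ge0.
rewrite exprS EFinM -muleA; congr (_ * _).
rewrite -ge0_integralZl//; last 3 first.
- apply: (measurable_fun_fubini_tonelli_F (fun z : R * 'rV[R]_k =>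
  g (c *: cons_rV z)%R)) => //.
  by apply: measurableT_comp mgs _; exact: measurable_cons_rV.
- by move=> x _; exact: integral_ge0.
- by rewrite lee_fin exprn_ge0// ltW.
apply: eq_integral => t _.
rewrite -[RHS]IH; last 2 first.
- exact: (measurableT_comp mgc (measurable_pair1 _)).
- by move=> x.
by congr (_ * _); apply: eq_integral => y _; rewrite cons_rVZ.
Qed.

End lebesgue_rV_integral.

(** * Gaussian weights and orthogonal invariance *)

Lemma measurable_EFinT d (T : measurableType d) (R : realType) (f : T -> R) :
  measurable_fun setT f -> measurable_fun setT (fun x => (f x)%:E).
Proof. by move=> mf; apply/measurable_EFinP. Qed.

Section gaussian.
Context {R : realType}.

(** A weight that depends on the norm alone and also factors over coordinates. It serves twice: as
    the averaging kernel behind orthogonal invariance, and as the dominating function behind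
    continuity in s. *)
Definition gauss k (x : 'rV[R]_k) : R := expR (- dot x x).

Lemma dotC k (x y : 'rV[R]_k) : dot x y = dot y x.
Proof. by rewrite !dotE; apply: eq_bigr => i _; rewrite mulrC. Qed.

Lemma dotDl k (x y z : 'rV[R]_k) : dot (x + y) z = dot x z + dot y z.
Proof. by rewrite /dot mulmxDl mxE. Qed.

Lemma dotDr k (x y z : 'rV[R]_k) : dot z (x + y) = dot z x + dot z y.
Proof. by rewrite !(dotC z) dotDl. Qed.

Lemma dotZl k (c : R) (x z : 'rV[R]_k) : dot (c *: x) z = c * dot x z.
Proof. by rewrite /dot -scalemxAl mxE. Qed.

Lemma dotZr k (c : R) (x z : 'rV[R]_k) : dot z (c *: x) = c * dot z x.
Proof. by rewrite !(dotC z) dotZl. Qed.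

Lemma dot_ge0 k (x : 'rV[R]_k) : 0 <= dot x x.
Proof. by rewrite dotE; apply: sumr_ge0 => i _; rewrite -expr2 sqr_ge0. Qed.

Lemma sqr_norm2 k (x : 'rV[R]_k) : norm2 x ^+ 2 = dot x x.
Proof. exact/sqr_sqrtr/dot_ge0. Qed.

Lemma norm2Z k (c : R) (x : 'rV[R]_k) : norm2 (c *: x) = `|c| * norm2 x.
Proof.
by rewrite /norm2 dotZl dotZr mulrA -expr2 sqrtrM ?sqr_ge0// sqrtr_sqr.
Qed.

Lemma dot_mulmx k l (x : 'rV[R]_k) (M : 'M[R]_(k, l)) (y : 'rV[R]_l) :
  dot (x *m M) y = dot x (y *m M^T).
Proof. by rewrite /dot trmx_mul trmxK mulmxA. Qed.

Lemma dot_orthogonal k l (x y : 'rV[R]_k) (M : 'M[R]_(k, l))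
  : M *m M^T = 1%:M ->
  dot (x *m M) (y *m M) = dot x y.
Proof. by move=> MM; rewrite dot_mulmx -mulmxA MM mulmx1. Qed.

Lemma norm2_orthogonal k l (x : 'rV[R]_k) (M : 'M[R]_(k, l))
  : M *m M^T = 1%:M ->
  norm2 (x *m M) = norm2 x.
Proof. by move=> MM; rewrite /norm2 dot_orthogonal. Qed.

Lemma dot_cons k (x y : R * 'rV[R]_k) :
  dot (cons_rV x) (cons_rV y) = x.1 * y.1 + dot x.2 y.2.
Proof.
have c0 (z : R * 'rV[R]_k) : cons_rV z ord0 ord0 = z.1.
  by have /(congr1 fst) := cons_rVK z.
have cS (z : R * 'rV[R]_k) i : cons_rV z ord0 (lift ord0 i) = z.2 ord0 i.
  have /(congr1 snd)/= <- := cons_rVK z; rewrite [RHS]mxE.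
  by congr (cons_rV _ _ _); apply/val_inj.
by rewrite !dotE big_ord_recl !c0; congr (_ + _); apply: eq_bigr => i _;
  rewrite !cS.
Qed.

Lemma measurable_dot k d (T : measurableType d) (f g : T -> 'rV[R]_k) :
  measurable_fun setT f -> measurable_fun setT g ->
  measurable_fun setT (fun x => dot (f x) (g x)).
Proof.
move=> mf mg; under eq_fun do rewrite dotE.
by apply: measurable_sum => i; apply: measurable_funM;
  apply: (measurableT_comp (measurable_coord i)).
Qed.

Lemma measurable_gauss k : measurable_fun setT (@gauss k).
Proof.
apply: measurableT_comp => //; apply: measurableT_comp => //.
by apply: measurable_dot; exact: measurable_id.
Qed.

Lemma gauss_ge0 k (x : 'rV[R]_k) : 0 <= gauss x.
Proof. exact: expR_ge0. Qed.

Lemma gauss_cons k (z : R * 'rV[R]_k) :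
  gauss (cons_rV z) = expR (- z.1 ^+ 2) * gauss z.2.
Proof. by rewrite /gauss dot_cons -expr2 opprD expRD. Qed.

(** Factoring out one coordinate at a time gives c = pi^(k/2). Positivity and finiteness are what
    allow c to be cancelled later. *)
Lemma integral_gauss k : exists2 c : R, 0 < c &
  (\int[lebesgue_rV R k]_x (gauss x)%:E = c%:E)%E.
Proof.
elim: k => [|k [c c0 ck]].
  exists 1 => //; rewrite (ge0_integral_rV0 (measurable_EFinT
    (@measurable_gauss 0))).
  by rewrite /gauss dotE big_ord0 oppr0 expR0.
have [d d0 dE] : exists2 d : R, 0 < d & (\int[lebesgue_measure]_t (expR (- t ^+
  2))%:E = d%:E)%E.
  exists (Num.sqrt pi); first by rewrite sqrtr_gt0 pi_gt0.
  exact: integralT_gauss.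
exists (d * c); first exact: mulr_gt0.
rewrite (ge0_integral_rVS (measurable_EFinT (@measurable_gauss k.+1)));
  last first.
  by move=> x; rewrite lee_fin gauss_ge0.
transitivity (\int[lebesgue_measure]_t ((expR (- t ^+ 2))%:E * c%:E))%E.
  apply: eq_integral => t _; under eq_integral do rewrite gauss_cons EFinM.
  rewrite /= ge0_integralZl_EFin ?ck ?expR_ge0//.
    by move=> x _; rewrite lee_fin gauss_ge0.
  exact: (measurable_EFinT (@measurable_gauss k)).
rewrite ge0_integralZr//.
- by rewrite dE.
- exact: (measurable_EFinT measurable_gauss_fun).
- by rewrite lee_fin ltW.
Qed.
End gaussian.

Section orthogonal.
Local Open Scope ereal_scope.
Context {R : realType}.

Lemma measurable_subrV d (T : measurableType d) n (g h : T -> 'rV[R]_n) :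
  measurable_fun setT g -> measurable_fun setT h ->
  measurable_fun setT (fun x => g x - h x)%R.
Proof.
move=> mg mh; apply: measurable_fun_rV => i; under eq_fun do rewrite !mxE.
by apply: measurable_funB;
  [exact: (measurableT_comp (measurable_coord i) mg)
  |exact: (measurableT_comp (measurable_coord i) mh)].
Qed.

Lemma gauss_orthogonal k l (M : 'M[R]_(k, l)) (x : 'rV[R]_k) :
  M *m M^T = 1%:M -> gauss (x *m M) = gauss x.
Proof. by move=> MM; rewrite /gauss dot_orthogonal. Qed.

Lemma gaussN k (x : 'rV[R]_k) : gauss (- x)%R = gauss x.
Proof. by rewrite /gauss -[(- x)%R]scaleN1r dotZl dotZr !mulN1r opprK. Qed.

(* Convolving with a rotation-invariant Gaussian and translating gives
   [c * \int g (x Q) = c * \int g x] with [c] the integral of the Gaussian, so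
   that determinants are not needed. *)
Lemma ge0_integral_orthogonal k (Q : 'M[R]_k) (g : 'rV[R]_k -> \bar R) :
  Q *m Q^T = 1%:M -> measurable_fun setT g -> (forall x, 0 <= g x) ->
  \int[lebesgue_rV R k]_x g (x *m Q) = \int[lebesgue_rV R k]_x g x.
Proof.
move=> QQ mg g0; set L := lebesgue_rV R k.
have QTQ : Q^T *m Q = 1%:M by exact: mulmx1C.
have [c c0 cE] := @integral_gauss R k.
have G0 (x : 'rV[R]_k) : 0 <= (gauss x)%:E by rewrite lee_fin gauss_ge0.
have mG d (T : measurableType d) (h : T -> 'rV[R]_k) :
    measurable_fun setT h -> measurable_fun setT (fun z => (gauss (h z))%:E).
  by move=> mh; exact: (measurableT_comp (measurable_EFinT (@measurable_gauss R
    k)) mh).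
have mid : measurable_fun setT (fun x : 'rV[R]_k => x) by exact: measurable_id.
have mfst : measurable_fun setT (fun z : 'rV[R]_k * 'rV[R]_k => z.1).
  exact: measurable_fst.
have msnd : measurable_fun setT (fun z : 'rV[R]_k * 'rV[R]_k => z.2).
  exact: measurable_snd.
have mQ d (T : measurableType d) (h : T -> 'rV[R]_k) :
    measurable_fun setT h -> measurable_fun setT (fun z => h z *m Q).
  exact: measurable_mulmx_rV.
have mgQ := measurableT_comp mg (mQ _ _ _ mid).
have swap (F : 'rV[R]_k * 'rV[R]_k -> \bar R) :
    measurable_fun setT F -> (forall z, 0 <= F z) ->
    \int[L]_x \int[L]_y F (x, y) = \int[L]_y \int[L]_x F (x, y).
  by move=> mF F0; exact: (@fubini_tonelli _ _ _ _ _ L L F mF F0).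
suff E : c%:E * \int[L]_x g (x *m Q) = c%:E * \int[L]_x g x.
  have V : (c^-1 * c)%:E = 1%:E :> \bar R by rewrite mulVf// gt_eqF.
  by rewrite -[LHS]mul1e -[RHS]mul1e -V EFinM -!muleA E.
transitivity (\int[L]_x \int[L]_y (g (x *m Q) * (gauss y)%:E)).
  rewrite -ge0_integralZl_EFin//; last exact: ltW.
  apply: eq_integral => x _.
  by rewrite ge0_integralZl// ?cE 1?muleC//; exact: mG.
rewrite (swap (fun z => g (z.1 *m Q) * (gauss z.2)%:E)); last 2 first.
- apply: emeasurable_funM; [exact: (measurableT_comp mg (mQ _ _ _ mfst))|exact:
  mG].
- by move=> z; exact: mule_ge0.
(* For fixed y, x is translated by [y *m Q^T], which Q maps to y. Once y occurs inside g, a second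
   translation can make the argument of g a free variable. *)
transitivity (\int[L]_y \int[L]_x (g (x *m Q + y)%R * (gauss y)%:E)).
  apply: eq_integral => y _ /=.
  rewrite -(ge0_integral_rV_shift (y *m Q^T)); last 2 first.
  - by apply: emeasurable_funM; [exact: mgQ|exact: measurable_cst].
  - by move=> z; exact: mule_ge0.
  by apply: eq_integral => x _; rewrite mulmxDl -mulmxA QTQ mulmx1.
rewrite -(swap (fun z => g (z.1 *m Q + z.2)%R * (gauss z.2)%:E)); last 2 first.
- apply: emeasurable_funM; [|exact: mG].
  by apply: measurableT_comp mg _; apply: measurable_addrV => //; exact: mQ.
- by move=> z; exact: mule_ge0.
transitivity (\int[L]_x \int[L]_y (g y * (gauss (y - x *m Q)%R)%:E)).
  apply: eq_integral => x _ /=.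
  rewrite -[RHS](ge0_integral_rV_shift (x *m Q)); last 2 first.
  - by apply: emeasurable_funM mg _; apply: mG; exact: measurable_subrV.
  - by move=> z; exact: mule_ge0.
  by apply: eq_integral => y _; rewrite addrK addrC.
rewrite (swap (fun z => g z.2 * (gauss (z.2 - z.1 *m Q)%R)%:E)); last 2 first.
- apply: emeasurable_funM; first exact: measurableT_comp mg msnd.
  by apply: mG; apply: measurable_subrV => //; exact: mQ.
- by move=> z; exact: mule_ge0.
(* Rotation invariance enters here: [gauss (y - x *m Q)] equals [gauss (x - y *m Q^T)], whose
   integral over x does not depend on y. *)
transitivity (\int[L]_y \int[L]_x (g y * (gauss x)%:E)).
  apply: eq_integral => y _ /=.
  rewrite -[RHS](ge0_integral_rV_shift (- (y *m Q^T))%R); last 2 first.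
  - by apply: emeasurable_funM; [exact: measurable_cst|exact: (mG _ _ _ mid)].
  - by move=> z; exact: mule_ge0.
  apply: eq_integral => x _; congr (_ * _%:E).
  rewrite -[in RHS](gauss_orthogonal _ QQ) mulmxBl -mulmxA QTQ mulmx1.
  by rewrite -[(y - _)%R]opprB gaussN.
rewrite -ge0_integralZl_EFin//; last exact: ltW.
apply: eq_integral => x _.
by rewrite ge0_integralZl// ?cE 1?muleC//; exact: mG.
Qed.
End orthogonal.

(** * Sphere measure and polar coordinates *)

Section sphere.
Local Open Scope ereal_scope.
Context {R : realType}.
Local Notation mu := (@lebesgue_measure R).

Lemma ge0_integral_mrestr d (T : measurableType d)
    (m : {measure set T -> \bar R}) (D : set T) (mD : measurable D)
    (f : T -> \bar R) :
  measurable_fun setT f -> (forall x, 0 <= f x) ->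
  \int[mrestr m mD]_x f x = \int[m]_(x in D) f x.
Proof.
move=> mf f0; rewrite -(setUv D) ge0_integral_setU//; last 3 first.
- exact: measurableC.
- by rewrite setUv.
- by rewrite disj_set2E setICr.
rewrite [X in _ + X]null_set_integral//; last 3 first.
- exact: measurableC.
- exact: measurable_funTS.
- by change (m (~` D `&` D) = 0); rewrite setICl measure0.
rewrite adde0; apply: eq_measure_integral => A mA AD /=.
by rewrite /mrestr setIidl.
Qed.

Lemma integral_indicM d (T : measurableType d)
    (m : {measure set T -> \bar R}) (D : set T) (f : T -> \bar R) :
  \int[m]_(x in D) f x = \int[m]_x ((\1_D x)%:E * f x).
Proof.
rewrite integral_mkcond; apply: eq_integral => x _.
by rewrite patchE indicE; case: ifPn => xD; rewrite ?mul1e ?mul0e.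
Qed.

Definition punctured_ball k (r : R) : set 'rV[R]_k :=
  [set x | (0 < norm2 x <= r)%R].

Lemma measurable_punctured_ball k r : measurable (@punctured_ball k r).
Proof.
have -> : @punctured_ball k r = setT `&` @norm2 R k @^-1` `]0%R, r].
  by rewrite setTI; apply/seteqP; split=> x; rewrite /punctured_ball /= in_itv.
exact: measurable_norm2.
Qed.

(** On nonnegative reals, 0 included, the inverse is the real power of exponent -1. This is why
    several denominators below appear under an absolute value. *)
Lemma measurable_ge0_inv d (T : measurableType d) (f : T -> R) :
  measurable_fun setT f -> (forall x, 0 <= f x)%R ->
  measurable_fun setT (fun x => (f x)^-1)%R.
Proof.
move=> mf f0.
have -> : (fun x => (f x)^-1)%R = (@powR R ^~ (-1)%R) \o f.
  by apply/funext => x /=; rewrite powR_inv1.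
by apply: measurableT_comp mf; exact: measurable_powR.
Qed.

Lemma measurable_radial k (r : R) :
  measurable_fun setT (fun x : 'rV[R]_k => (r / norm2 x) *: x)%R.
Proof.
apply: measurable_scale_rV; last exact: measurable_id.
apply: measurable_funM => //.
by apply: measurable_ge0_inv (@measurable_norm2 R k) _ => x; exact: sqrtr_ge0.
Qed.

(** [cone r A] is the part of the punctured ball that radial projection sends into A, so
    [sphere_measure r] is a multiple of the image of Lebesgue measure under that projection.
    Invariances of Lebesgue measure thereby pass to spheres. *)
Lemma ge0_integral_sphere k (r : R) (g : 'rV[R]_k -> \bar R) : (0 < r)%R ->
  measurable_fun setT g -> (forall x, 0 <= g x) ->
  \int[@sphere_measure R k r]_x g x =
  (k%:R / r)%:E * \int[lebesgue_rV R k]_(x in punctured_ball r)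
    g ((r / norm2 x) *: x)%R.
Proof.
move=> r0 mg g0.
set c : {nonneg R} := NngNum (divr_ge0 (ler0n R k) (normr_ge0 r)).
pose m1 := [the measure _ _ of mrestr (lebesgue_rV R k)
  (@measurable_punctured_ball k r)].
transitivity (\int[mscale c (pushforward_measure m1 (@measurable_radial k
  r))]_x g x).
  by apply: eq_measure_integral => A mA _.
rewrite ge0_integral_mscale//; congr (_ * _).
  by rewrite /c/= gtr0_norm.
have := ge0_integral_pushforward (@measurable_radial k r)
  m1 measurableT mg (fun y _ => g0 y).
rewrite preimage_setT => E; apply: (eq_trans E).
rewrite ge0_integral_mrestr //.
  exact: (measurableT_comp mg (@measurable_radial k r)).
by move=> x /=.
Qed.

Lemma norm2_radial k (r : R) (x : 'rV[R]_k) : punctured_ball r x ->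
  norm2 ((r / norm2 x) *: x)%R = r.
Proof.
move=> /andP[x0 xr]; have r0 := lt_le_trans x0 xr.
by rewrite norm2Z gtr0_norm ?divr_gt0// divfK// gt_eqF.
Qed.

(** The measure is defined on all of R^k but concentrated on the sphere, because radial projection
    of the punctured ball lands there. *)
Lemma eq_sphere_integral k (r : R) (g h : 'rV[R]_k -> \bar R) : (0 < r)%R ->
  measurable_fun setT g -> (forall x, 0 <= g x) ->
  measurable_fun setT h -> (forall x, 0 <= h x) ->
  (forall x, norm2 x = r -> g x = h x) ->
  \int[@sphere_measure R k r]_x g x = \int[@sphere_measure R k r]_x h x.
Proof.
move=> r0 mg g0 mh h0 gh; rewrite (ge0_integral_sphere r0 mg g0)
  (ge0_integral_sphere r0 mh h0).
congr (_ * _); apply: eq_integral => x; rewrite inE => rx.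
by rewrite gh// norm2_radial.
Qed.

(** On the ball, 1 is at most e^(r^2) times the Gaussian, which has a finite integral. *)
Lemma lebesgue_punctured_ball k (r : R) : lebesgue_rV R k (punctured_ball r)
  < +oo.
Proof.
have [c c0 cE] := @integral_gauss R k.
have mP := @measurable_punctured_ball k r.
rewrite -[X in X < _]mul1e -integral_cst//.
apply: (@le_lt_trans _ _ (\int[lebesgue_rV R k]_(x in punctured_ball r)
  ((expR (r ^+ 2))%:E * (gauss x)%:E))).
  apply: ge0_le_integral => //.
  - apply: measurable_funTS; apply: emeasurable_funM;
    first exact: measurable_cst.
    exact: (measurable_EFinT (@measurable_gauss R k)).
  - move=> x /andP[x0 xr]; rewrite -EFinM lee_fin /gauss -expRD -expR0 ler_expR.
    rewrite subr_ge0 -sqr_norm2 ler_sqr// nnegrE; first exact: ltW.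
    by rewrite (le_trans _ xr)// ltW.
apply: (@le_lt_trans _ _ (\int[lebesgue_rV R k]_x ((expR (r ^+ 2))%:E * (gauss
  x)%:E))).
  apply: ge0_subset_integral => //.
  - apply: emeasurable_funM; first exact: measurable_cst.
    exact: (measurable_EFinT (@measurable_gauss R k)).
  - by move=> x _; rewrite mule_ge0// lee_fin ?expR_ge0 ?gauss_ge0.
rewrite ge0_integralZl_EFin ?expR_ge0//.
- by rewrite cE ltry.
- by move=> x _; rewrite lee_fin gauss_ge0.
- exact: (measurable_EFinT (@measurable_gauss R k)).
Qed.

(** Finiteness gives the sigma-finiteness that Tonelli's theorem asks for, and makes [sphere_area],
    a [fine], the actual total mass. *)
Lemma sphere_measure_fin_num k (r : R) : fin_num_fun (@sphere_measure R k r).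
Proof.
move=> A mA; rewrite ge0_fin_numE//.
apply: (@le_lt_trans _ _ (@sphere_measure R k r setT)).
  by apply: le_measure; rewrite ?inE.
rewrite /sphere_measure (_ : cone r setT = punctured_ball r); last first.
  by apply/seteqP; split => x [].
by rewrite lte_mul_pinfty ?lebesgue_punctured_ball// lee_fin divr_ge0.
Qed.

HB.instance Definition _ k (r : R) :=
  Measure_isFinite.Build _ _ _ (@sphere_measure R k r)
    (@sphere_measure_fin_num k r).

End sphere.

(** The antiderivative [- (t^-1 ^+ k.+1)] vanishes at infinity. With c = |x| the value cancels the
    factor |x|^(k+1) left over in the proof of polar coordinates. *)
Lemma integral_tail_power (R : realType) (k : nat) (c : R) : 0 < c ->
  (\int[lebesgue_measure]_(t in `[c, +oo[) (k.+1%:R * t^-1 ^+ k.+2)%:E = (c^-1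
    ^+ k.+1)%:E)%E.
Proof.
move=> c0.
have cV (x : R) : 0 < x -> {for x, continuous (fun t : R => t^-1)}.
  by move=> x0; apply: cvgV; [rewrite gt_eqF|exact: cvg_id].
have cVX n (x : R) : 0 < x -> {for x, continuous (fun t : R => t^-1 ^+ n)}.
  move=> x0; apply: (@continuous_comp _ _ _ (fun t : R => t^-1) (fun t =>
    t ^+ n)).
    exact: cV.
  exact: exprn_continuous.
have dV (x : R) : 0 < x ->
    is_derive x 1 (fun t : R => - (t^-1 ^+ k.+1)) (k.+1%:R * x^-1 ^+ k.+2).
  move=> x0; have x0' : x != 0 by rewrite gt_eqF.
  have H : is_derive x 1 (fun t : R => t^-1) (- x ^- 2 *: 1).
    split; first by apply: derivableV => //; exact: derivable_id.
    by rewrite deriveV//; rewrite derive_id.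
  have -> : (fun t : R => - (t^-1 ^+ k.+1)) = - ((fun t : R => t^-1) ^+ k.+1).
    by apply/funext => t; rewrite !fctE.
  apply: is_derive_eq (is_deriveN (is_deriveX k.+1 H)) _.
  by rewrite /GRing.scale/= mulr1 -exprVn !exprS; ring.
rewrite (@ge0_continuous_FTC2y _ _ (fun t => - (t^-1 ^+ k.+1)) _ 0).
- by rewrite -EFinB sub0r opprK.
- by move=> x cx; rewrite mulr_ge0// exprn_ge0// invr_ge0 (le_trans _ cx)// ltW.
- apply: continuous_in_subspaceT => x; rewrite inE/= in_itv/= andbT => cx.
  have x0 := lt_le_trans c0 cx.
  apply: cvgM; first exact: cvg_cst.
  exact: cVX.
- rewrite -oppr0; apply: cvgN.
  have /cvg_comp : (fun t : R => t^-1) x @[x --> +oo] --> (0 : R).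
    apply/gtr0_cvgV0; last by exact: cvg_id.
    by near=> x; near: x; exact: nbhs_pinfty_gt.
  move=> /(_ _ (fun t : R => t ^+ k.+1) (nbhs (0 ^+ k.+1 : R))
    (@exprn_continuous _ k.+1 0)).
  by rewrite expr0n.
- by move=> x cx; have /dV[] := lt_trans c0 cx.
- apply: cvg_at_right_filter; apply: cvgN.
  exact: cVX.
- move=> x; rewrite in_itv/= andbT => cx; have D := dV _ (lt_trans c0 cx).
  by rewrite derive1E derive_val.
Unshelve. all: end_near. Qed.

Section polar.
Local Open Scope ereal_scope.
Context {R : realType}.
Local Notation mu := (@lebesgue_measure R).

Lemma indic_punctured_ball k (r : R) (x : 'rV[R]_k) :
  \1_(punctured_ball r) x = (0 < norm2 x <= r)%R%:R%R :> R.
Proof. by rewrite indicE; congr (nat_of_bool _)%:R%R; apply/idP/idP;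
  rewrite inE. Qed.

(** Rescaling the ball in dimension k+1 costs r^(k+1); the prefactor (k+1)/r of the sphere measure
    takes one power back. *)
Lemma ge0_integral_sphere_scale k (r : R) (g : 'rV[R]_k.+1 ->
  \bar R) : (0 < r)%R ->
  measurable_fun setT g -> (forall x, 0 <= g x) ->
  \int[@sphere_measure R k.+1 r]_x g x =
  (r ^+ k)%:E * \int[@sphere_measure R k.+1 1]_x g (r *: x)%R.
Proof.
move=> r0 mg g0.
have mgr : measurable_fun setT (fun x : 'rV[R]_k.+1 => g (r *: x)%R).
  by apply: measurableT_comp mg _; apply: measurable_scale_rV => //;
    exact: measurable_id.
rewrite (ge0_integral_sphere r0 mg g0).
rewrite [X in _ = _ * X](ge0_integral_sphere ltr01 mgr (fun x =>
  g0 _)) !(integral_indicM _ (punctured_ball _)).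
rewrite -(ge0_integral_rV_scale r0); last 2 first.
- apply: emeasurable_funM.
    by apply: measurable_EFinT; apply: measurable_indic;
      exact: measurable_punctured_ball.
  exact: (measurableT_comp mg (measurable_radial _)).
- by move=> x; apply: mule_ge0 => //; rewrite lee_fin.
rewrite !muleA -!EFinM; congr (_%:E * _).
  by rewrite exprS; field; rewrite gt_eqF.
apply: eq_integral => x _.
rewrite !indic_punctured_ball norm2Z gtr0_norm// pmulr_rgt0//.
rewrite -[X in (_ <= X)%R]mulr1 ler_pM2l//.
case: (boolP (0 < norm2 x <= 1)%R) => [/andP[x0 x1]|_]; last by rewrite !mul0e.
rewrite !mul1e; congr g; rewrite !scalerA; congr (_ *: _)%R.
by field; rewrite !gt_eqF.
Qed.

Lemma ge0_integral_sphere_orthogonal k (Q : 'M[R]_k) (r : R) (g : 'rV[R]_k ->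
  \bar R) :
  (0 < r)%R -> Q *m Q^T = 1%:M ->
  measurable_fun setT g -> (forall x, 0 <= g x) ->
  \int[@sphere_measure R k r]_x g (x *m Q) = \int[@sphere_measure R k r]_x g x.
Proof.
move=> r0 QQ mg g0.
have mid : measurable_fun setT (fun x : 'rV[R]_k => x) by exact: measurable_id.
have mgQ := measurableT_comp mg (measurable_mulmx_rV Q mid).
rewrite [RHS](ge0_integral_sphere r0 mg g0) [LHS](ge0_integral_sphere r0 mgQ
  (fun x => g0 _)).
congr (_ * _); rewrite !(integral_indicM _ (punctured_ball _))
  -[RHS](ge0_integral_orthogonal QQ); last 2 first.
- apply: emeasurable_funM.
    by apply: measurable_EFinT; apply: measurable_indic;
      exact: measurable_punctured_ball.
  exact: (measurableT_comp mg (measurable_radial _)).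
- by move=> x; apply: mule_ge0 => //; rewrite lee_fin.
apply: eq_integral => x _.
rewrite !indic_punctured_ball norm2_orthogonal//.
by rewrite scalemxAl.
Qed.

Lemma indic_gt0 (t : R) : \1_(`]0%R, +oo[%classic : set R)
  t = (0 < t)%R%:R%R :> R.
Proof. by rewrite indicE mem_setE in_itv/= andbT. Qed.

Lemma norm2_gt0 k (x : 'rV[R]_k) : x != 0%R -> (0 < norm2 x)%R.
Proof.
move=> x0; rewrite lt_neqAle sqrtr_ge0 andbT eq_sym.
apply: contra x0 => /eqP x0; move: (sqr_norm2 x).
rewrite x0 expr0n/= dotE => /esym/eqP.
rewrite psumr_eq0 => [/allP H|i _]; last by rewrite -expr2 sqr_ge0.
apply/eqP/rowP => i; rewrite [RHS]mxE; apply/eqP.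
by have := H i (mem_index_enum i); rewrite /= mulf_eq0 orbb.
Qed.

Lemma cons_rV_eq0 k (z : R * 'rV[R]_k) : cons_rV z = 0%R -> z.1 = 0%R.
Proof. by move=> z0; have /(congr1 fst)/= <- := cons_rVK z; rewrite z0 mxE. Qed.

Lemma measurable_integral_cons k (g : 'rV[R]_k.+1 -> \bar R) :
  measurable_fun setT g -> (forall x, 0 <= g x) ->
  measurable_fun setT (fun t => \int[lebesgue_rV R k]_y g (cons_rV (t, y))).
Proof.
move=> mg g0.
apply: (measurable_fun_fubini_tonelli_F (fun z => g (cons_rV z))) => //.
exact: (measurableT_comp mg (@measurable_cons_rV R k)).
Qed.

(** The origin lies in the slice where the first coordinate is 0, and that slice is null. The
    dimension is a successor because in dimension 0 Lebesgue measure is a Dirac mass at the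
    origin. *)
Lemma ge0_integral_rV_neq0 k (g : 'rV[R]_k.+1 -> \bar R) :
  measurable_fun setT g -> (forall x, 0 <= g x) ->
  \int[lebesgue_rV R k.+1]_x ((0 < norm2 x)%R%:R%:E * g x) =
  \int[lebesgue_rV R k.+1]_x g x.
Proof.
move=> mg g0.
have mn : measurable_fun setT (fun x : 'rV[R]_k.+1 =>
  (0 < norm2 x)%R%:R%:E * g x).
  apply: emeasurable_funM => //; apply: measurable_EFinT.
  under eq_fun do rewrite -indic_gt0.
  apply: (measurableT_comp _ (@measurable_norm2 R k.+1)).
  exact: measurable_indic.
have n0 (x : 'rV[R]_k.+1) : 0 <= (0 < norm2 x)%R%:R%:E * g x.
  by apply: mule_ge0 => //; rewrite lee_fin ler0n.
rewrite (ge0_integral_rVS mn n0) (ge0_integral_rVS mg g0).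
have mD : measurable ([set: R] `\ 0%R) by exact: measurableD.
rewrite -(integral_setD1 mD (measurable_funTS (measurable_integral_cons mn
  n0))).
rewrite -[RHS](integral_setD1 mD (measurable_funTS (measurable_integral_cons mg
  g0))).
apply: eq_integral => t; rewrite inE => -[_ /= t0].
apply: eq_integral => y _; rewrite norm2_gt0 ?mul1e//.
by apply/negP => /eqP/cons_rV_eq0.
Qed.

(* With the sphere integral unfolded into an integral over the unit ball, the
   right-hand side is rescaled twice, by t -> |x| t and then by x -> x / t; the
   integral over t that remains is [integral_tail_power]. *)
Lemma ge0_integral_polar k (g : 'rV[R]_k.+1 -> \bar R) :
  measurable_fun setT g -> (forall x, 0 <= g x) ->
  \int[lebesgue_rV R k.+1]_x g x =
  \int[mu]_(t in `]0%R, +oo[)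
    ((t ^+ k)%:E * \int[@sphere_measure R k.+1 1]_x g (t *: x)%R).
Proof.
move=> mg g0; set L := lebesgue_rV R k.+1.
have mfst : measurable_fun setT (fun z : R * 'rV[R]_k.+1 =>
  z.1) by exact: measurable_fst.
have msnd : measurable_fun setT (fun z : R * 'rV[R]_k.+1 =>
  z.2) by exact: measurable_snd.
have mn : measurable_fun setT (fun z : R * 'rV[R]_k.+1 => norm2 z.2).
  exact: (measurableT_comp (@measurable_norm2 R k.+1) msnd).
have mP : measurable_fun setT (fun z : R * 'rV[R]_k.+1 =>
  \1_(punctured_ball 1) z.2 : R).
  by apply: measurableT_comp msnd; apply: measurable_indic;
    exact: measurable_punctured_ball.
have m0 : measurable_fun setT (fun z : R * 'rV[R]_k.+1 =>
  \1_(`]0%R, +oo[%classic : set R) z.1 : R).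
  by apply: measurableT_comp mfst; exact: measurable_indic.
have swap (F : R * 'rV[R]_k.+1 -> \bar R) :
    measurable_fun setT F -> (forall z, 0 <= F z) ->
    \int[mu]_t \int[L]_x F (t, x) = \int[L]_x \int[mu]_t F (t, x).
  by move=> mF F0; exact: (@fubini_tonelli _ _ _ _ _ mu L F mF F0).
(* [F1], [F2] and [F3] are the integrands before, between and after the two rescalings. The power of
   t in [F3] is k - (k+1) - (k+1) = -(k+2), from t^k, from |x / t|^(k+1) and from the Jacobian of x
   -> x / t. For t <= 0 all three vanish; the absolute values keep each factor nonnegative there. *)
pose F1 (z : R * 'rV[R]_k.+1) := (\1_(`]0%R, +oo[%classic : set R) z.1 *
  \1_(punctured_ball 1) z.2 * (k.+1%:R * `|z.1| ^+ k))%:E * g ((z.1 / norm2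
    z.2) *: z.2)%R.
pose F2 (z : R * 'rV[R]_k.+1) := (\1_(`]0%R, +oo[%classic : set R) z.1 *
  \1_(punctured_ball 1) z.2 * (k.+1%:R * `|z.1| ^+ k * norm2 z.2 ^+ k.+1))%:E *
    g (z.1 *: z.2)%R.
pose F3 (z : R * 'rV[R]_k.+1) := (((0 < norm2 z.2) && (norm2 z.2 <= z.1))%R%:R *
  (k.+1%:R * `|z.1|^-1 ^+ k.+2 * norm2 z.2 ^+ k.+1))%:E * g z.2.
have F1_ge0 z : 0 <= F1 z.
  by rewrite mule_ge0// lee_fin !mulr_ge0 ?exprn_ge0// ?indicE.
have F2_ge0 z : 0 <= F2 z.
  by rewrite mule_ge0// lee_fin !mulr_ge0 ?exprn_ge0// ?indicE// ?sqrtr_ge0.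
have F3_ge0 z : 0 <= F3 z.
  rewrite mule_ge0// lee_fin; apply: mulr_ge0; first exact: ler0n.
  by apply: mulr_ge0; [apply: mulr_ge0|]; rewrite ?ler0n//
    exprn_ge0 ?invr_ge0 ?sqrtr_ge0.
have mF1 : measurable_fun setT F1.
  apply: emeasurable_funM.
    apply: measurable_EFinT; apply: measurable_funM;
      first exact: measurable_funM.
    apply: measurable_funM => //; apply: measurable_funX.
    exact: measurableT_comp mfst.
  apply: measurableT_comp mg _; apply: measurable_scale_rV => //.
  apply: measurable_funM => //.
  by apply: measurable_ge0_inv mn _ => z; exact: sqrtr_ge0.
have mF2 : measurable_fun setT F2.
  apply: emeasurable_funM.
    apply: measurable_EFinT; apply: measurable_funM;
      first exact: measurable_funM.
    apply: measurable_funM; last exact: measurable_funX.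
    apply: measurable_funM => //; apply: measurable_funX.
    exact: measurableT_comp mfst.
  by apply: measurableT_comp mg _; exact: measurable_scale_rV.
have mF3 : measurable_fun setT F3.
  apply: emeasurable_funM; last exact: measurableT_comp mg msnd.
  apply: measurable_EFinT; apply: measurable_funM; last first.
    apply: measurable_funM; last exact: measurable_funX.
    apply: measurable_funM => //; apply: measurable_funX.
    apply: measurable_ge0_inv => //.
    exact: measurableT_comp mfst.
  rewrite (_ : (fun z => _) = (fun z => \1_(`]0%R, +oo[%classic : set R)
    (norm2 z.2) *
       \1_(`[0%R, +oo[%classic : set R) (z.1 - norm2 z.2))%R).
    apply: measurable_funM.
      by apply: measurableT_comp mn; exact: measurable_indic.
    apply: (measurableT_comp (measurable_indic _)) => //.
    exact: measurable_funB.
  apply/funext => z; rewrite !indicE !mem_setE !in_itv/= !andbT subr_ge0.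
  by case: (0 < _)%R; rewrite ?mul1r ?mul0r.
rewrite [RHS]integral_indicM.
transitivity (\int[mu]_t \int[L]_x F1 (t, x)); last first.
  apply: eq_integral => t _.
  have mgt : measurable_fun setT (fun x : 'rV[R]_k.+1 => g (t *: x)%R).
    by apply: measurableT_comp mg _; apply: measurable_scale_rV => //;
      exact: measurable_id.
  rewrite [X in _ = _ * (_ * X)](ge0_integral_sphere ltr01 mgt (fun x => g0 _)).
  rewrite (integral_indicM _ (punctured_ball _)) !muleA -!EFinM indic_gt0.
  case: (ltP 0%R t) => t0; last first.
    rewrite !mul0r mul0e integral0_eq// => x _.
    by rewrite /F1 /= indic_gt0 ltNge t0 !mul0r mul0e.
  rewrite -ge0_integralZl_EFin.
  - apply: eq_integral => x _; rewrite /F1/= indic_gt0 t0 muleA -EFinM.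
    by rewrite ger0_norm ?(ltW t0)// scalerA; congr (_%:E * g (_ *: _)%R);
      [rewrite divr1/=; ring|rewrite div1r].
  - exact: measurableT.
  - by move=> x _; rewrite mule_ge0// lee_fin indicE.
  - apply: emeasurable_funM.
      by apply: measurable_EFinT; apply: measurable_indic;
        exact: measurable_punctured_ball.
    exact: (measurableT_comp mgt (measurable_radial _)).
  - by rewrite divr1 mulr_ge0// mulr_ge0// exprn_ge0// ltW.
rewrite (swap _ mF1 F1_ge0).
transitivity (\int[L]_x \int[mu]_t F2 (t, x)); last first.
  apply: eq_integral => x _.
  case: (boolP (0 < norm2 x <= 1)%R) => [/andP[x0 x1]|x0]; last first.
    by apply: eq_integral => t _; rewrite /F1 /F2/= indic_punctured_ball (negPf
      x0) !mulr0 !mul0r !mul0e.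
  have mF1x : measurable_fun setT (fun t => F1 (t, x)).
    exact: (measurableT_comp mF1 (pair2_measurable x)).
  have mF1s : measurable_fun setT (fun t : R => F1 ((norm2 x * t)%R, x)).
    by apply: (measurableT_comp mF1x); exact: measurable_funM.
  rewrite -[RHS](ge0_integral_scale x0 mF1x) // -[RHS]ge0_integralZl_EFin//;
    last exact: ltW.
  apply: eq_integral => t _; rewrite /F1 /F2 /= !indic_gt0 pmulr_rgt0//
    muleA -EFinM.
  rewrite [(norm2 x * t)%R]mulrC mulfK ?gt_eqF// normrM (gtr0_norm x0)
    exprMn exprS.
  by congr (_%:E * _); ring.
rewrite -(swap _ mF2 F2_ge0).
transitivity (\int[mu]_t \int[L]_x F3 (t, x)); last first.
  apply: eq_integral => t _; case: (ltP 0%R t) => t0; last first.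
    apply: eq_integral => x _; rewrite /F2 /F3/= indic_gt0 [(0 < t)%R]ltNge t0
      !mul0r.
    case: (boolP (0 < norm2 x <= t)%R) => [/andP[x0 xt]|_];
      last by rewrite mul0r !mul0e.
    by have := lt_le_trans x0 (le_trans xt t0); rewrite ltxx.
  have mF3t : measurable_fun setT (fun x => F3 (t, x)).
    exact: (measurableT_comp mF3 (pair1_measurable t)).
  have mF3s : measurable_fun setT (fun x : 'rV[R]_k.+1 => F3 (t, t *: x)%R).
    by apply: (measurableT_comp mF3t); apply: measurable_scale_rV => //;
      exact: measurable_id.
  rewrite -[LHS](ge0_integral_rV_scale t0 mF3t)// -[LHS]ge0_integralZl_EFin//;
    last first.
    by rewrite exprn_ge0// ltW.
  apply: eq_integral => x _; rewrite /F2 /F3/= indic_gt0 t0 muleA -EFinM.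
  rewrite indic_punctured_ball norm2Z (gtr0_norm t0) pmulr_rgt0//
    -[X in (_ <= X)%R]mulr1 ler_pM2l//.
  rewrite mul1r mulrCA; congr ((_ * _)%:E * _); rewrite exprVn exprMn !exprS;
    field.
  by rewrite expf_neq0 ?gt_eqF.
rewrite (swap _ mF3 F3_ge0) -(ge0_integral_rV_neq0 mg g0).
apply: eq_integral => x _; case: (ltP 0%R (norm2 x)) => x0; last first.
  rewrite mul0e integral0_eq// => t _.
  by rewrite /F3/= ltNge x0 mul0r mul0e.
transitivity (\int[mu]_(t in `[norm2 x, +oo[)
   ((k.+1%:R * `|t|^-1 ^+ k.+2)%:E * ((norm2 x ^+ k.+1)%:E * g x))); last first.
  rewrite [LHS]integral_indicM; apply: eq_integral => t _;
    rewrite /F3/= x0 indicE mem_setE in_itv/= andbT.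
  case: (leP (norm2 x) t) => xt; last by rewrite mul0r !mul0e.
  by rewrite mul1e mul1r muleA -EFinM.
rewrite ge0_integralZr//.
- rewrite (_ : \int[mu]_(t in _) _ = \int[mu]_(t in `[norm2 x, +oo[)
  (k.+1%:R * t^-1 ^+ k.+2)%:E).
    rewrite integral_tail_power// muleA -EFinM -exprMn mulVf ?gt_eqF//.
    by rewrite expr1n mul1e.
  apply: eq_integral => t; rewrite inE /= in_itv/= andbT => xt.
  by rewrite ger0_norm// (le_trans _ xt)// ltW.
- apply: measurable_funTS; apply: measurable_EFinT; apply: measurable_funM =>
  //.
  by apply: measurable_funX; apply: measurable_ge0_inv.
- by rewrite mule_ge0// lee_fin exprn_ge0// ltW.
Qed.
End polar.

(** * Borel functions of row vectors and measurable frames *)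

Section frames.
Context {R : realType}.

(** The sigma-algebra is generated by the coordinates, while the topology is that of the sup norm,
    whose balls are cubes. Cubes with rational centre and radius 1/(N+1) form a countable base. *)
Lemma open_measurable_rV n (U : set 'rV[R]_n) : open U -> measurable U.
Proof.
move=> oU.
pose cube (z : 'rV[rat]_n * nat) : set 'rV[R]_n :=
  [set x | forall i, `|ratr (z.1 ord0 i) - x ord0 i| < z.2.+1%:R^-1].
have mcube z : measurable (cube z).
  rewrite (_ : cube z = \bigcap_(i in [set: 'I_n]) ((fun x : 'rV[R]_n =>
    x ord0 i) @^-1`
      [set y | `|ratr (z.1 ord0 i) - y| < z.2.+1%:R^-1])); last first.
    by apply/seteqP; split => [x cx i _|x cx i]; [exact: cx|exact: cx].
  apply: fin_bigcap_measurable => [|i _]; first exact: finite_finset.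
  rewrite -[X in measurable X]setTI; apply: measurable_coord => //.
  rewrite (_ : [set y | _] = ball (ratr (z.1 ord0 i) : R) z.2.+1%:R^-1)//.
  exact: measurable_ball.
rewrite (_ : U = \bigcup_z (if `[< cube z `<=` U >] then cube z else set0)).
  apply: countable_bigcupT_measurable => [|z]; first exact: countableP.
  by case: asboolP.
apply/seteqP; split => [x Ux|x [z _]]; last by case: asboolP => // zU;
  exact: zU.
have /nbhs_ballP[e /= e0 eU] := open_nbhs_nbhs (conj oU Ux).
have [N eN] : exists N : nat, N.+1%:R^-1 < e / 2.
  by have [N] := ltr_add_invr (divr_gt0 e0 (ltr0n R 2)); rewrite add0r;
    exists N.
have N0 : 0 < N.+1%:R^-1 :> R by rewrite invr_gt0.
have /choice[q qx] : forall i : 'I_n, exists q : rat,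
  `|ratr q - x ord0 i| < (N.+1%:R^-1 : R).
  move=> i; have : x ord0 i - N.+1%:R^-1 < x ord0 i + N.+1%:R^-1.
    by rewrite ltrBlDr -addrA ltrDl addr_gt0.
  by move=> /rat_in_itvoo[q]; rewrite in_itv/= -ltr_distl; exists q.
exists (\row_i q i, N) => //; case: asboolP => [_|[]].
  by move=> i; rewrite mxE.
move=> y cy; apply: eU; split => // i j.
have := cy j; have := qx j; rewrite !mxE (ord1 i) /ball/= => h1 h2.
rewrite -(subrKA (ratr (q j))) (le_lt_trans (ler_normD _ _))// [e]splitr.
by rewrite ltrD// (lt_trans _ eN)// distrC.
Qed.

Lemma continuous_measurable_rV n (f : 'rV[R]_n -> R) :
  continuous f -> measurable_fun setT f.
Proof.
move=> cf; apply: (measurability _ (RGenOpens.measurableE R)).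
move=> _ [_ [a [b ->] <-]]; rewrite setTI; apply: open_measurable_rV.
by move/continuousP : cf; apply; exact: interval_open.
Qed.
End frames.

Section householder.
Context {R : realType}.

(** The reflection in the hyperplane orthogonal to u. For u = 0 it is the identity, so the frame
    below is also correct when w is the first basis vector. *)
Definition reflection n (u x : 'rV[R]_n) : 'rV[R]_n :=
  x - (2 / dot u u * dot x u) *: u.

Lemma dot_eq0 n (u : 'rV[R]_n) : dot u u = 0 -> u = 0.
Proof.
move=> uu; apply/eqP/negPn/negP => /norm2_gt0.
by rewrite /norm2 uu sqrtr0 ltxx.
Qed.

Lemma dot0l n (u : 'rV[R]_n) : dot 0 u = 0.
Proof. by rewrite /dot mul0mx mxE. Qed.

Lemma dotBl n (x y z : 'rV[R]_n) : dot (x - y) z = dot x z - dot y z.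
Proof. by rewrite dotDl -scaleN1r dotZl mulN1r. Qed.

Lemma dotBr n (x y z : 'rV[R]_n) : dot z (x - y) = dot z x - dot z y.
Proof. by rewrite !(dotC z) dotBl. Qed.

Lemma dot_reflection n (u x y : 'rV[R]_n) :
  dot (reflection u x) (reflection u y) = dot x y.
Proof.
rewrite /reflection !(dotBl, dotBr, dotZl, dotZr) (dotC u y).
have [/dot_eq0 ->|u0] := eqVneq (dot u u) 0.
  by rewrite !(dotC _ 0) !dot0l !mulr0 !subr0.
by field.
Qed.

(** Equal lengths give |w - e|^2 = -2 e . (w - e), so the coefficient of w - e in the reflection of
    e is -1. *)
Lemma reflection_swap n (e w : 'rV[R]_n) : dot e e = dot w w ->
  reflection (w - e) e = w.
Proof.
move=> ew; rewrite /reflection; have [/dot_eq0 u0|u0] :=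
  eqVneq (dot (w - e) (w - e)) 0.
  by rewrite u0 scaler0 subr0; apply/esym/eqP; rewrite -subr_eq0 u0.
have -> : 2 / dot (w - e) (w - e) * dot e (w - e) = -1.
  have E : dot (w - e) (w - e) = - (2 * dot e (w - e)).
    by rewrite !(dotBl, dotBr) (dotC w e) -ew; ring.
  rewrite E; move: u0; rewrite E => u0; field.
  by move: u0; rewrite oppr_eq0 mulf_eq0 negb_or => /andP[].
by rewrite scaleN1r opprK addrC subrK.
Qed.

Definition basis0 n : 'rV[R]_n.+1 := delta_mx ord0 ord0.

(* [perp_frame w] is obtained by choice, so it is not known to be measurable in
   w; hyperplane integrals do not depend on the frame (lemma
   [ge0_integral_frame]), and this one is explicit. *)
Definition householder n (w : 'rV[R]_n.+1) : 'M[R]_(n, n.+1) :=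
  \matrix_(i, j) reflection (w - basis0 n) (delta_mx ord0 (lift ord0 i)) ord0 j.

Lemma dot_delta n (i j : 'I_n) :
  dot (delta_mx ord0 i : 'rV[R]_n) (delta_mx ord0 j) = (i == j)%:R.
Proof. by rewrite /dot trmx_delta mul_delta_mx_cond; case: eqP => _;
  rewrite !mxE. Qed.

Lemma householderP n (w : 'rV[R]_n.+1) : norm2 w = 1 ->
  is_perp_frame w (householder w).
Proof.
move=> w1; have ww : dot w w = 1 by rewrite -sqr_norm2 w1 expr1n.
have row_hh i : row i (householder w) = reflection (w - basis0 n)
  (delta_mx ord0 (lift ord0 i)).
  by apply/rowP => j; rewrite !mxE.
have we : reflection (w - basis0 n) (basis0 n) = w.
  by apply: reflection_swap; rewrite ww dot_delta eqxx.
split; apply/matrixP => i j.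
  transitivity (dot (row i (householder w)) (row j (householder w))).
    by rewrite dotE mxE; apply: eq_bigr => l _; rewrite !mxE.
  by rewrite !row_hh dot_reflection dot_delta mxE (inj_eq lift_inj).
transitivity (dot (row i (householder w)) w).
  by rewrite dotE mxE; apply: eq_bigr => l _; rewrite !mxE (ord1 j).
by rewrite row_hh -[X in dot _ X]we dot_reflection dot_delta mxE.
Qed.

(** The entries are rational in w with a single nonnegative denominator. Joint measurability in w
    and y is what permits Tonelli's theorem over directions and hyperplane points together. *)
Lemma measurable_householder n d (T : measurableType d) (w : T -> 'rV[R]_n.+1)
    (y : T -> 'rV[R]_n) : measurable_fun setT w -> measurable_fun setT y ->
  measurable_fun setT (fun z => y z *m householder (w z)).
Proof.
move=> mw my; apply: measurable_fun_rV => j; under eq_fun do rewrite mxE.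
apply: measurable_sum => i; apply: measurable_funM.
  exact: (measurableT_comp (measurable_coord i) my).
under eq_fun do rewrite mxE.
apply: (measurableT_comp (measurable_coord j)).
have mu : measurable_fun setT (fun z => w z - basis0 n).
  by apply: measurable_subrV => //; exact: measurable_cst.
apply: measurable_subrV; first exact: measurable_cst.
apply: measurable_scale_rV => //; apply: measurable_funM.
  apply: measurable_funM => //; apply: measurable_ge0_inv;
    first exact: measurable_dot.
  by move=> z; exact: dot_ge0.
by apply: measurable_dot => //; exact: measurable_cst.
Qed.

Definition frame_mx n (w : 'rV[R]_n.+1) (F : 'M[R]_(n, n.+1)) : 'M[R]_n.+1 :=
  (col_mx w F : 'M[R]_(1 + n, n.+1)).

Lemma cons_frame_mx n (z : R * 'rV[R]_n) w F :
  cons_rV z *m frame_mx w F = z.1 *: w + z.2 *m F.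
Proof. by rewrite /cons_rV /frame_mx (@mul_row_col _ 1 1 n) mul_scalar_mx. Qed.

Lemma frame_mx_orthogonal n (w : 'rV[R]_n.+1) F : norm2 w = 1 ->
  is_perp_frame w F -> frame_mx w F *m (frame_mx w F)^T = 1%:M.
Proof.
move=> w1 [FF Fw].
have ww : w *m w^T = 1%:M.
  by rewrite [LHS]mx11_scalar -/(dot w w) -sqr_norm2 w1 expr1n.
have wF : w *m F^T = 0 by rewrite -[LHS]trmxK trmx_mul trmxK Fw trmx0.
rewrite /frame_mx (@tr_col_mx _ 1 n) (@mul_col_row _ 1 n _ 1 n) ww FF Fw wF.
exact/esym/(@scalar_mx_block _ 1 n).
Qed.

End householder.

(** * Averages over hyperplanes *)

Section hyperplane_averages.
Local Open Scope ereal_scope.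
Context {R : realType} (m : nat).
Local Notation mu := (@lebesgue_measure R).
Local Notation L := (lebesgue_rV R m.+1).
Local Notation S := (@sphere_measure R m.+1 1).
Variables (v : 'rV[R]_m.+2) (E : 'M[R]_(m.+1, m.+2)).
Hypotheses (v1 : norm2 v = 1%R) (vE : is_perp_frame v E).
Variable u : 'rV[R]_m.+2 -> \bar R.
Hypotheses (meas_u : measurable_fun setT u) (u0 : forall x, 0 <= u x).

Definition axis_integral (y : 'rV[R]_m.+1) : \bar R :=
  \int[mu]_t u (t *: v + y *m E)%R.

(** This is A(r) of the overview, with n = m.+2. Scaling the argument over the unit sphere, rather
    than integrating over the sphere of radius r, keeps the formula meaningful at r = 0. *)
Definition sphere_axis_integral (r : R) : \bar R :=
  \int[S]_x axis_integral (r *: x)%R.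

(** Phi(s) of the overview, written with the explicit frame so that the integrand is jointly
    measurable. *)
Definition hyperplane_average (s : R) : \bar R :=
  \int[S]_x \int[L]_y u (s *: (x *m E) + y *m householder (x *m E))%R.

(** Psi(s) of the overview. *)
Definition shell_integral (s : R) : \bar R :=
  \int[lebesgue_rV R m]_z sphere_axis_integral (norm2 (cons_rV (s, z))).

Let mid k : measurable_fun setT (fun x : 'rV[R]_k => x).
Proof. exact: measurable_id. Qed.

Let measurable_axis : measurable_fun setT (fun z : 'rV[R]_m.+1 * R =>
  u (z.2 *: v + z.1 *m E)%R).
Proof.
apply: measurableT_comp meas_u _; apply: measurable_addrV.
  by apply: measurable_scalerV; exact: measurable_snd.
by apply: measurable_mulmx_rV; exact: measurable_fst.
Qed.

Lemma axis_integral_ge0 y : 0 <= axis_integral y.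
Proof. exact: integral_ge0. Qed.

Lemma measurable_axis_integral : measurable_fun setT axis_integral.
Proof.
apply: (measurable_fun_fubini_tonelli_F
  (fun z : 'rV[R]_m.+1 * measurableTypeR R => u (z.2 *: v + z.1 *m E)%R)) => //.
Qed.

Lemma sphere_axis_integral_ge0 r : 0 <= sphere_axis_integral r.
Proof. by apply: integral_ge0 => x _; exact: axis_integral_ge0. Qed.

Let measurable_axis_scale :
  measurable_fun setT (fun z : R * 'rV[R]_m.+1 => axis_integral (z.1 *: z.2)%R).
Proof.
apply: measurableT_comp measurable_axis_integral _; apply: measurable_scale_rV.
  exact: measurable_fst.
exact: measurable_snd.
Qed.

Lemma measurable_sphere_axis_integral : measurable_fun setT
  sphere_axis_integral.
Proof.
apply: (measurable_fun_fubini_tonelli_F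
  (fun z : R * 'rV[R]_m.+1 => axis_integral (z.1 *: z.2)%R)) => //.
by move=> z; exact: axis_integral_ge0.
Qed.

Let measurable_plane : measurable_fun setT (fun z : (R * 'rV[R]_m.+1)
  * 'rV[R]_m.+1 =>
  u (z.1.1 *: (z.1.2 *m E) + z.2 *m householder (z.1.2 *m E))%R).
Proof.
have m12 : measurable_fun setT (fun z : (R * 'rV[R]_m.+1) * 'rV[R]_m.+1 =>
  z.1.2 *m E).
  by apply: measurable_mulmx_rV; exact: (measurableT_comp measurable_snd
    measurable_fst).
apply: measurableT_comp meas_u _; apply: measurable_addrV.
  apply: measurable_scale_rV m12; exact: (measurableT_comp measurable_fst
    measurable_fst).
by apply: measurable_householder m12 _; exact: measurable_snd.
Qed.

Lemma measurable_plane_integral : measurable_fun setT (fun z : R * 'rV[R]_m.+1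
  =>
  \int[L]_y u (z.1 *: (z.2 *m E) + y *m householder (z.2 *m E))%R).
Proof.
exact: (measurable_fun_fubini_tonelli_F
  (fun z : (R * 'rV[R]_m.+1) * 'rV[R]_m.+1 =>
     u (z.1.1 *: (z.1.2 *m E) + z.2 *m householder (z.1.2 *m E))%R)).
Qed.

Lemma hyperplane_average_ge0 s : 0 <= hyperplane_average s.
Proof. by apply: integral_ge0 => x _; exact: integral_ge0. Qed.

Lemma norm2_frame (x : 'rV[R]_m.+1) : norm2 (x *m E) = norm2 x.
Proof. by case: vE => EE _; rewrite norm2_orthogonal. Qed.

Variable phi : R -> \bar R.
Hypotheses (mphi : measurable_fun setT phi) (phi0 : forall s, 0 <= phi s).

(* Both frames (w, householder w) and (v, E) are orthonormal bases of R^n, so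
   either integral is the integral of [phi (x . w) u x] over R^n. *)
Lemma integral_hyperplane_axis (x : 'rV[R]_m.+1) : norm2 x = 1%R ->
  \int[mu]_s (phi s * \int[L]_y u (s *: (x *m E) + y *m householder (x *m
    E))%R) =
  \int[L]_y (phi (dot y x) * axis_integral y).
Proof.
move=> x1; set w := x *m E; have w1 : norm2 w = 1%R by rewrite norm2_frame.
have FQ := frame_mx_orthogonal w1 (householderP w1).
have vQ := frame_mx_orthogonal v1 vE.
case: vE => EE Ev.
pose V (z : 'rV[R]_m.+2) := phi (dot z w) * u z.
have V0 z : 0 <= V z by rewrite mule_ge0.
have mV : measurable_fun setT V.
  apply: emeasurable_funM meas_u; apply: (measurableT_comp mphi).
  by apply: measurable_dot => //; exact: measurable_cst.
have mVQ (Q : 'M[R]_m.+2) : measurable_fun setT (fun z => V (z *m Q)).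
  by apply: measurableT_comp mV _; exact: measurable_mulmx_rV.
transitivity (\int[lebesgue_rV R m.+2]_z V (z *m frame_mx w (householder w))).
  rewrite (ge0_integral_rVS (mVQ _) (fun z => V0 _)); apply: eq_integral => s _.
  rewrite -ge0_integralZl//.
    apply: eq_integral => y _; rewrite /V cons_frame_mx/=; congr (phi _ * _).
    case: (householderP w1) => _ Fw.
    rewrite dotDl dotZl -[dot w w]sqr_norm2 w1 expr1n mulr1 /dot -mulmxA Fw.
    by rewrite mulmx0 mxE addr0.
  apply: measurableT_comp meas_u _; apply: measurable_addrV.
    exact: measurable_cst.
  exact: measurable_mulmx_rV.
rewrite (ge0_integral_orthogonal FQ mV V0) -(ge0_integral_orthogonal vQ mV V0).
rewrite (ge0_integral_rVS_swap (mVQ _) (fun z => V0 _)); apply: eq_integral =>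
  y _.
rewrite -ge0_integralZl//.
  apply: eq_integral => t _; rewrite /V cons_frame_mx/=; congr (phi _ * _).
  have vx : dot v w = 0%R by rewrite dotC /w /dot -mulmxA Ev mulmx0 mxE.
  by rewrite dotDl dotZl vx mulr0 add0r dot_orthogonal.
exact: (measurableT_comp measurable_axis (pair1_measurable y)).
Qed.

Let measurable_phi_dot :
  measurable_fun setT (fun z : 'rV[R]_m.+1 * 'rV[R]_m.+1 => phi (dot z.1 z.2)).
Proof.
apply: (measurableT_comp mphi).
by apply: measurable_dot; [exact: measurable_fst|exact: measurable_snd].
Qed.

Lemma basis0E : basis0 m = cons_rV (1%R, 0%R : 'rV[R]_m).
Proof.
rewrite -[LHS]behead_rVK; congr (cons_rV (_, _)); first by rewrite mxE.
by apply/rowP => i; rewrite !mxE.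
Qed.

(** The orthogonal matrix whose first row is x carries the first basis vector to x, and the sphere
    measure is invariant under it. *)
Lemma sphere_integral_dot (r : R) (x : 'rV[R]_m.+1) : norm2 x = 1%R ->
  \int[S]_z phi (dot (r *: x)%R z) = \int[S]_z phi (dot (r *: basis0 m)%R z).
Proof.
move=> x1; have Q := frame_mx_orthogonal x1 (householderP x1).
rewrite -(ge0_integral_sphere_orthogonal ltr01 Q (g := fun z =>
  phi (dot (r *: x)%R z))) //.
  apply: eq_integral => z _.
  have {1}-> : x = basis0 m *m frame_mx x (householder x).
    by rewrite basis0E cons_frame_mx/= scale1r mul0mx addr0.
  by rewrite scalemxAl dot_orthogonal.
exact: (measurableT_comp measurable_phi_dot (pair1_measurable _)).
Qed.

Lemma integral_average_shell :
  \int[mu]_s (phi s * hyperplane_average s) = \int[mu]_s (phi s *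
    shell_integral s).
Proof.
transitivity (\int[mu]_s \int[S]_x (phi s *
    \int[L]_y u (s *: (x *m E) + y *m householder (x *m E))%R)).
  apply: eq_integral => s _; rewrite ge0_integralZl//.
  - exact: (measurableT_comp measurable_plane_integral (pair1_measurable s)).
  - by move=> x _; exact: integral_ge0.
pose F (z : R * 'rV[R]_m.+1) := phi z.1 *
  \int[L]_y u (z.1 *: (z.2 *m E) + y *m householder (z.2 *m E))%R.
have F0 z : 0 <= F z by rewrite mule_ge0// integral_ge0.
have mF : measurable_fun setT F.
  by apply: emeasurable_funM measurable_plane_integral;
    exact: (measurableT_comp mphi measurable_fst).
rewrite (@fubini_tonelli _ _ _ _ _ mu S F mF F0).
pose G (z : 'rV[R]_m.+1 * 'rV[R]_m.+1) := phi (dot z.1 z.2) * axis_integral z.1.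
have G0 z : 0 <= G z by rewrite mule_ge0// axis_integral_ge0.
have mG : measurable_fun setT G.
  by apply: emeasurable_funM measurable_phi_dot _;
    exact: (measurableT_comp measurable_axis_integral measurable_fst).
transitivity (\int[S]_x \int[L]_y G (y, x)).
  apply: (eq_sphere_integral ltr01).
  - exact: (@measurable_fun_fubini_tonelli_G _ _ _ _ R mu F mF F0).
  - by move=> x; exact: integral_ge0.
  - exact: (@measurable_fun_fubini_tonelli_G _ _ _ _ R L G mG G0).
  - by move=> x; exact: integral_ge0.
  - by move=> x x1; exact: integral_hyperplane_axis.
rewrite -(@fubini_tonelli _ _ _ _ _ L S G mG G0).
(* [T y] depends on [norm2 y] alone, so on each sphere it is a constant, evaluated at
   [r *: basis0 m], and phi separates from u. *)
pose T y := \int[S]_x phi (dot y x).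
have T0 y : 0 <= T y by exact: integral_ge0.
have mT : measurable_fun setT T.
  exact: (measurable_fun_fubini_tonelli_F (fun z : 'rV[R]_m.+1 * 'rV[R]_m.+1 =>
    phi (dot z.1 z.2))).
have -> : \int[L]_x \int[S]_y G (x, y) = \int[L]_y (T y * axis_integral y).
  apply: eq_integral => y _; rewrite /G /T/= ge0_integralZr//.
  - exact: (measurableT_comp measurable_phi_dot (pair1_measurable _)).
  - exact: axis_integral_ge0.
rewrite ge0_integral_polar; last 2 first.
- by apply: emeasurable_funM mT _; exact: measurable_axis_integral.
- by move=> y; rewrite mule_ge0// axis_integral_ge0.
(* At radius r, both [T y * axis_integral y] and [W y] have the spherical integral T(r e0) A(r),
   where e0 is the first basis vector: one averages u against a constant, the other averages phi
   against a constant. In [W] the first coordinate of y becomes the variable s of Psi. *)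
pose W y := phi (dot (basis0 m) y) * sphere_axis_integral (norm2 y).
have W0 y : 0 <= W y by rewrite mule_ge0// sphere_axis_integral_ge0.
have mW : measurable_fun setT W.
  apply: emeasurable_funM.
    exact: (measurableT_comp measurable_phi_dot (pair1_measurable _)).
  exact: (measurableT_comp measurable_sphere_axis_integral (@measurable_norm2 R
    m.+1)).
transitivity (\int[L]_y W y); last first.
  rewrite (ge0_integral_rVS mW W0); apply: eq_integral => s _.
  rewrite -ge0_integralZl//; last 2 first.
  - apply: (measurableT_comp measurable_sphere_axis_integral).
    apply: (measurableT_comp (@measurable_norm2 R m.+1)).
    exact: (measurableT_comp (@measurable_cons_rV R m) (pair1_measurable s)).
  - by move=> z _; exact: sphere_axis_integral_ge0.
  apply: eq_integral => z _; rewrite /W basis0E dot_cons/= mul1r dot0l addr0//.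
rewrite (ge0_integral_polar mW W0); apply: eq_integral => r.
rewrite inE/= in_itv/= andbT => r0; congr (_ * _).
have mS k (h : 'rV[R]_m.+1 -> \bar R) : measurable_fun setT h ->
    measurable_fun setT (fun x : 'rV[R]_m.+1 => h (k *: x)%R).
  by move=> mh; apply: measurableT_comp mh _; apply: measurable_scale_rV.
transitivity (\int[S]_x (T (r *: basis0 m)%R * axis_integral (r *: x)%R)).
  apply: (eq_sphere_integral ltr01).
  - apply: (mS _ (fun y => T y * axis_integral y)).
    by apply: emeasurable_funM mT _; exact: measurable_axis_integral.
  - by move=> y; rewrite mule_ge0// axis_integral_ge0.
  - apply: emeasurable_funM; first exact: measurable_cst.
    exact: (mS _ _ measurable_axis_integral).
  - by move=> y; rewrite mule_ge0// axis_integral_ge0.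
  - by move=> y y1; rewrite /T sphere_integral_dot.
transitivity (\int[S]_x (phi (dot (r *: basis0 m)%R x)
  * sphere_axis_integral r)); last first.
  apply: (eq_sphere_integral ltr01).
  - apply: emeasurable_funM; last exact: measurable_cst.
    exact: (measurableT_comp measurable_phi_dot (pair1_measurable _)).
  - by move=> y; rewrite mule_ge0// sphere_axis_integral_ge0.
  - exact: (mS _ _ mW).
  - by move=> y; exact: W0.
  - move=> y y1; rewrite /W norm2Z y1 mulr1 gtr0_norm//.
    by rewrite dotZl dotZr.
rewrite ge0_integralZl//; last 2 first.
- exact: (mS _ _ measurable_axis_integral).
- by move=> y _; exact: axis_integral_ge0.
rewrite ge0_integralZr//.
- exact: (measurableT_comp measurable_phi_dot (pair1_measurable _)).
- exact: sphere_axis_integral_ge0.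
Qed.
End hyperplane_averages.

(** * Continuity in s and passage from averages to values *)

Section continuity.
Context {R : realType}.
Local Notation mu := (@lebesgue_measure R).

(** Dominated convergence with a bound g uniform in s. The integral is returned as a real function,
    finiteness included, because the comparison in [ge0_integral_test_eq] is between real
    functions. *)
Lemma continuous_ge0_integral d (X : measurableType d)
    (P : {measure set X -> \bar R}) (U : R -> X -> R) (g : X -> R) :
  (forall s, measurable_fun setT (U s)) -> (forall x, continuous (U^~ x)) ->
  P.-integrable setT (EFin \o g) -> (forall s x, 0 <= U s x <= g x) ->
  exists2 p : R -> R, continuous p &
    forall s, (\int[P]_x (U s x)%:E)%E = (p s)%:E.
Proof.
move=> mU cU ig Ug.
have iU s : P.-integrable setT (EFin \o U s).
  apply: le_integrable ig => //; first exact/measurable_EFinP.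
  move=> x _; have /andP[U0 Ugx] := Ug s x.
  by rewrite /= !ger0_norm ?lee_fin// (le_trans U0).
exists (fun s => \int[P]_x U s x)%R => [s|s]; last first.
  by rewrite /Rintegral fineK//; exact: (integrable_fin_num measurableT (iU s)).
apply: (@continuity_under_integral _ _ _ P U setT measurableT (s - 1) (s + 1)
  _ _ g ig).
- by move=> t _; exact: iU.
- by apply: aeW => x _ t _; exact: cU.
- move=> t _; apply: aeW => x _; have /andP[U0 Ugx] := Ug t x.
  by rewrite ger0_norm.
- by rewrite inE/= in_itv/= ltrDl ltrBlDr ltrDl ltr01.
Qed.

(** If G < F at s, the strict inequality persists on a ball, and the indicator of that ball is a
    test function that contradicts the assumption. Exchanging F and G gives the other inequality. *)
Lemma ge0_integral_test_eq (F G : R -> R) :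
  (forall s, 0 <= F s) -> (forall s, 0 <= G s) -> continuous F ->
    continuous G ->
  (forall phi : R -> \bar R, measurable_fun setT phi ->
    (forall s, 0 <= phi s)%E ->
    \int[mu]_s (phi s * (F s)%:E) = \int[mu]_s (phi s * (G s)%:E))%E ->
  forall s, F s <= G s.
Proof.
move=> F0 G0 cF cG FG s; rewrite leNgt; apply/negP => GFs.
(* Integration only preserves weak inequalities; two constants c1 < c2 between G and F make the
   integrals over the ball differ strictly. *)
have [c1 /andP[Gc1 c1F]] : exists c, G s < c < F s.
  by exists ((G s + F s) / 2); rewrite midf_lt//= midf_lt.
have [c2 /andP[c12 c2F]] : exists c, c1 < c < F s.
  by exists ((c1 + F s) / 2); rewrite midf_lt//= midf_lt.
have : \forall x \near s, G x < c1 /\ c2 < F x.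
  near=> x; split; near: x.
  - exact: (cvgr_lt _ (cG s) _ Gc1).
  - exact: (cvgr_gt _ (cF s) _ c2F).
move=> [e /= e0 eGF].
have mB : measurable (ball s e : set R) by exact: measurable_ball.
have := FG (EFin \o \1_(ball s e)) (measurable_EFinT (measurable_indic mB)).
rewrite -!integral_indicM => E.
have {}E : (\int[mu]_(x in ball s e) (F x)%:E = \int[mu]_(x in ball s e)
  (G x)%:E)%E.
  by apply: E => x; rewrite lee_fin indicE ler0n.
have mF : measurable_fun setT F by exact: continuous_measurable_fun.
have mG : measurable_fun setT G by exact: continuous_measurable_fun.
have : (\int[mu]_(x in ball s e) (G x)%:E < \int[mu]_(x in ball s e)
  (F x)%:E)%E.
  apply: (@le_lt_trans _ _ (c1%:E * mu (ball s e))%E).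
    rewrite -integral_cst//; apply: ge0_le_integral => //.
    - by move=> x _; rewrite lee_fin.
    - exact/measurable_funTS/measurable_EFinT.
    - by move=> x bx; rewrite lee_fin; have [/ltW] := eGF _ bx.
  apply: (@lt_le_trans _ _ (c2%:E * mu (ball s e))%E).
    by rewrite lebesgue_measure_ball ?(ltW e0)// -!EFinM lte_fin ltr_pM2r//
      mulrn_wgt0.
  rewrite -integral_cst//; apply: ge0_le_integral => //.
  - move=> x _; rewrite lee_fin (le_trans _ (ltW c12))//
    (le_trans _ (ltW Gc1))//.
  - exact/measurable_funTS/measurable_EFinT.
  - by move=> x bx; rewrite lee_fin; have [_ /ltW] := eGF _ bx.
by rewrite E ltxx.
Unshelve. all: end_near. Qed.
End continuity.

Lemma integrable_prod_ge0 (R : realType) d1 d2 (X : measurableType d1)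
  (Y : measurableType d2)
    (P : {sigma_finite_measure set X -> \bar R})
    (Q : {sigma_finite_measure set Y -> \bar R}) (f : X -> R) (g : Y -> R) :
  (forall x, 0 <= f x) -> (forall y, 0 <= g y) ->
  P.-integrable setT (EFin \o f) -> Q.-integrable setT (EFin \o g) ->
  (P \x Q)%E.-integrable setT (fun z => (f z.1 * g z.2)%:E).
Proof.
move=> f0 g0 If Ig.
have [mf _] := integrableP _ _ _ If; have [mg _] := integrableP _ _ _ Ig.
move: mf mg => /measurable_EFinP mf /measurable_EFinP mg.
apply/integrable12ltyP.
  apply: measurable_EFinT; apply: measurable_funM.
    exact: (measurableT_comp mf measurable_fst).
  exact: (measurableT_comp mg measurable_snd).
have gfin : (\int[Q]_y (g y)%:E \is a fin_num)%E :=
  integrable_fin_num measurableT Ig.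
have ffin : (\int[P]_x (f x)%:E \is a fin_num)%E :=
  integrable_fin_num measurableT If.
rewrite (_ : (\int[P]_x _ = \int[P]_x ((f x)%:E * \int[Q]_y (g y)%:E))%E).
  rewrite ge0_integralZr//.
  - by rewrite -(fineK ffin) -(fineK gfin) -EFinM ltry.
  - exact: measurable_EFinT.
  - by move=> x _; rewrite lee_fin.
  - by apply: integral_ge0 => y _; rewrite lee_fin.
apply: eq_integral => x _; rewrite -ge0_integralZl_EFin//.
- by apply: eq_integral => y _; rewrite -EFinM gee0_abs// lee_fin mulr_ge0.
- by move=> y _; rewrite lee_fin.
- exact: measurable_EFinT.
Qed.

(* A Gaussian bound is all that is kept of the compact support: it factors along
   orthogonal decompositions of R^n, which gives integrable bounds that do not
   depend on s. *)
Section gaussian_decay.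
Context {R : realType} (m : nat).
Local Notation mu := (@lebesgue_measure R).
Local Notation L := (lebesgue_rV R m.+1).
Local Notation S := (@sphere_measure R m.+1 1).
Variables (v : 'rV[R]_m.+2) (E : 'M[R]_(m.+1, m.+2)).
Hypotheses (v1 : norm2 v = 1) (vE : is_perp_frame v E).
Variables (u : 'rV[R]_m.+2 -> R) (K : R).
Hypotheses (cu : continuous u) (u0 : forall x, 0 <= u x)
  (uK : forall x, u x <= K * gauss x).

Let meas_u : measurable_fun setT u := continuous_measurable_rV cu.

Let K0 : 0 <= K.
Proof. by have := le_trans (u0 0) (uK 0); rewrite pmulr_lge0// expR_gt0. Qed.

Let c_line (w c : 'rV[R]_m.+2) : continuous (fun s : R => u (s *: w + c)).
Proof.
move=> s; apply: (@continuous_comp _ _ _ (fun s : R => s *: w + c) u);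
  last exact: cu.
by apply: cvgD; [apply: cvgZl; exact: cvg_id|exact: cvg_cst].
Qed.

Let c_shell (w c : 'rV[R]_m.+2) (a : R) :
  continuous (fun s : R => u (Num.sqrt (s * s + a) *: w + c)).
Proof.
move=> s; apply: (@continuous_comp _ _ _ (fun s : R => Num.sqrt (s * s + a))
  (fun r => u (r *: w + c))); last exact: c_line.
apply: (@continuous_comp _ _ _ (fun s : R => s * s + a) Num.sqrt).
  by apply: cvgD; [apply: cvgM; exact: cvg_id|exact: cvg_cst].
exact: sqrt_continuous.
Qed.

Let Eu0 x : (0 <= (EFin \o u) x)%E. Proof. by rewrite lee_fin. Qed.

Lemma integrable_gauss k : (lebesgue_rV R k).-integrable setT (EFin \o (fun y
  => K * gauss y)).
Proof.
have [c c0 cE] := @integral_gauss R k.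
apply/integrableP; split.
  by apply/measurable_EFinP; apply: measurable_funM => //;
    exact: measurable_gauss.
under eq_integral => y _ do rewrite /= ger0_norm ?mulr_ge0 ?gauss_ge0// EFinM.
rewrite ge0_integralZl_EFin//.
- by rewrite cE ltry.
- by move=> x _; rewrite lee_fin gauss_ge0.
- exact: (measurable_EFinT (@measurable_gauss R k)).
Qed.

Let unit_sphere : set 'rV[R]_m.+1 := [set x | norm2 x = 1].

Let measurable_unit_sphere : measurable unit_sphere.
Proof.
rewrite (_ : unit_sphere = setT `&` @norm2 R m.+1 @^-1` [set 1]).
  exact: measurable_norm2.
by rewrite setTI.
Qed.

Let indic_unit (x : 'rV[R]_m.+1) : \1_unit_sphere x = (norm2 x == 1)%:R :> R.
Proof. by rewrite indicE; congr (nat_of_bool _)%:R; apply/idP/eqP;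
  rewrite inE. Qed.

Lemma gauss_frame (w : 'rV[R]_m.+2) (F : 'M[R]_(m.+1, m.+2))
  t y : norm2 w = 1 -> is_perp_frame w F ->
  gauss (t *: w + y *m F) = expR (- t ^+ 2) * gauss y.
Proof.
move=> w1 wF; rewrite -(cons_frame_mx (t, y)) gauss_orthogonal ?gauss_cons//.
exact: frame_mx_orthogonal.
Qed.

Lemma hyperplane_average_continuous : exists2 p : R -> R, continuous p &
  forall s, hyperplane_average E (EFin \o u) s = (p s)%:E.
Proof.
(* The bound on U must hold at every point of the product space, but [householder] is an orthonormal
   frame only at unit vectors; the indicator removes the other points, a null set for the sphere
   measure. *)
pose U (s : R) (z : 'rV[R]_m.+1 * 'rV[R]_m.+1) : R :=
  \1_unit_sphere z.1 * u (s *: (z.1 *m E) + z.2 *m householder (z.1 *m E)).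
have mU s : measurable_fun setT (U s).
  apply: measurable_funM.
    by apply: measurableT_comp measurable_fst; exact: measurable_indic.
  have m1 : measurable_fun setT (fun z : 'rV[R]_m.+1 * 'rV[R]_m.+1 => z.1 *m E).
    by apply: measurable_mulmx_rV; exact: measurable_fst.
  apply: measurableT_comp meas_u _; apply: measurable_addrV.
    by apply: measurable_scale_rV m1; exact: measurable_cst.
  by apply: measurable_householder m1 _; exact: measurable_snd.
have U0 s z : 0 <= U s z by rewrite mulr_ge0// indicE.
have [p cp pE] : exists2 p : R -> R, continuous p &
    forall s, (\int[S \x L]_z (U s z)%:E)%E = (p s)%:E.
  apply: (@continuous_ge0_integral _ _ _ _ U (fun z => 1 * (K * gauss z.2)) mU).
  - move=> z s; apply: cvgM; first exact: cvg_cst.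
    exact: c_line.
  - apply: (@integrable_prod_ge0 _ _ _ _ _ S L (cst 1) (fun y =>
    K * gauss y)) => //.
    + by move=> y; rewrite mulr_ge0// gauss_ge0.
    + exact: finite_measure_integrable_cst.
    + exact: integrable_gauss.
  - move=> s z; rewrite U0/= mul1r /U indic_unit; case: eqP => z1;
    rewrite ?mul0r ?mul1r; last first.
      by rewrite mulr_ge0// gauss_ge0.
    apply: le_trans (uK _) _; rewrite ler_wpM2l//.
    have w1 : norm2 (z.1 *m E) = 1 by rewrite norm2_orthogonal//; case: vE.
    rewrite (gauss_frame _ _ w1 (householderP w1)) ler_piMl ?gauss_ge0//.
    by rewrite -expR0 ler_expR oppr_le0 sqr_ge0.
have U0' s z : (0 <= (U s z)%:E)%E by rewrite lee_fin.
exists p => // s; rewrite -pE.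
rewrite (@fubini_tonelli1 _ _ _ _ _ S L _ (measurable_EFinT (mU s)) (U0' s)).
apply: (eq_sphere_integral ltr01).
- exact: (measurableT_comp (measurable_plane_integral E (measurable_EFinT
  meas_u) Eu0) (pair1_measurable s)).
- by move=> x; apply: integral_ge0 => y _; rewrite lee_fin.
- exact: (measurable_fun_fubini_tonelli_F _ (measurable_EFinT (mU s)) (U0' s)).
- by move=> x; apply: integral_ge0 => y _; rewrite lee_fin.
- move=> x x1; apply: eq_integral => y _.
  by rewrite /U/= indic_unit x1 eqxx mul1r.
Qed.

Lemma shell_integral_continuous : exists2 p : R -> R, continuous p &
  forall s, shell_integral v E (EFin \o u) s = (p s)%:E.
Proof.
(* The canonical sigma-finite structure of [_ \x _] is shadowed by the one for
   probability measures. *)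
pose M : {sigma_finite_measure set ('rV[R]_m.+1 * measurableTypeR R)%type ->
  \bar R} :=
  HB.pack_for {sigma_finite_measure set ('rV[R]_m.+1 * measurableTypeR R)%type
    -> \bar R}
    (S \x mu)%E (Measure_isSigmaFinite.Build _ _ _ (S \x mu)%E
      (lebesgue_integral_fubini.product_measure_sigma_finite_subproof S mu)).
pose U (s : R) (z : 'rV[R]_m * ('rV[R]_m.+1 * measurableTypeR R)) : R :=
  \1_unit_sphere z.2.1 * u (z.2.2 *: v + (norm2 (cons_rV (s, z.1)) *: z.2.1)
    *m E).
have mU s : measurable_fun setT (U s).
  have m21 : measurable_fun setT
      (fun z : 'rV[R]_m * ('rV[R]_m.+1 * measurableTypeR R) => z.2.1).
    exact: (measurableT_comp measurable_fst measurable_snd).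
  apply: measurable_funM.
    by apply: measurableT_comp m21; exact: measurable_indic.
  apply: measurableT_comp meas_u _; apply: measurable_addrV.
    apply: measurable_scale_rV; last exact: measurable_cst.
    exact: (measurableT_comp measurable_snd measurable_snd).
  apply: measurable_mulmx_rV; apply: measurable_scale_rV m21.
  apply: (measurableT_comp (@measurable_norm2 R m.+1)).
  apply: (measurableT_comp (@measurable_cons_rV R m)).
  exact: (measurableT_comp (pair1_measurable s) measurable_fst).
have cU z : continuous (U^~ z).
  have -> : U^~ z = (fun s => \1_unit_sphere z.2.1 *
      u (Num.sqrt (s * s + dot z.1 z.1) *: (z.2.1 *m E) + z.2.2 *: v)).
    by apply/funext => t; rewrite /U /norm2 dot_cons/= addrC scalemxAl.
  by move=> s; apply: cvgM; [exact: cvg_cst|exact: c_shell].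
have U0 s z : 0 <= U s z by rewrite mulr_ge0// indicE.
have [p cp pE] : exists2 p : R -> R, continuous p &
    forall s, (\int[lebesgue_rV R m \x M]_z (U s z)%:E)%E = (p s)%:E.
  (* For |x| = 1 the Gaussian at t v + |(s, z)| x E is e^(-t^2) e^(-s^2 - |z|^2). Bounding e^(-s^2)
     by 1 leaves a product of integrable functions of z and t, and the constant 1 is integrable on
     the finite sphere measure. *)
  apply: (@continuous_ge0_integral _ _ _ _ U
    (fun z => (K * gauss z.1) * (1 * gauss_fun z.2.2)) mU).
  - exact: cU.
  - apply: (@integrable_prod_ge0 _ _ _ _ _ (lebesgue_rV R m) M (fun y =>
    K * gauss y)
      (fun w => 1 * gauss_fun w.2)).
    + by move=> y; rewrite mulr_ge0// gauss_ge0.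
    + by move=> y; rewrite mul1r gauss_fun_ge0.
    + exact: integrable_gauss.
    + apply: (@integrable_prod_ge0 _ _ _ _ _ S mu (cst 1) gauss_fun) => //.
      * by move=> y; rewrite gauss_fun_ge0.
      * exact: finite_measure_integrable_cst.
      * exact: integrableT_gauss.
  - move=> s z; rewrite U0/= mul1r /U indic_unit; case: eqP => z1;
    rewrite ?mul0r ?mul1r; last first.
      exact: mulr_ge0 (mulr_ge0 K0 (gauss_ge0 _)) (gauss_fun_ge0 _).
    apply: le_trans (uK _) _; rewrite -mulrA (ler_wpM2l K0)//.
    rewrite (gauss_frame _ _ v1 vE) mulrC ler_wpM2r ?expR_ge0//.
    rewrite {1}/gauss -sqr_norm2 norm2Z z1 mulr1 ger0_norm ?sqrtr_ge0//
      sqr_norm2.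
    by rewrite dot_cons/= ler_expR lerN2 lerDr -expr2 sqr_ge0.
have U0' s z : (0 <= (U s z)%:E)%E by rewrite lee_fin.
exists p => // s; rewrite -pE.
rewrite (@fubini_tonelli1 _ _ _ _ _ (lebesgue_rV R m)
  M _ (measurable_EFinT (mU s)) (U0' s)).
apply: eq_integral => z _.
have mUz : measurable_fun setT (fun w => (U s (z, w))%:E).
  exact: (measurableT_comp (measurable_EFinT (mU s)) (pair1_measurable z)).
transitivity (\int[S]_x \int[mu]_t (U s (z, (x, t)))%:E)%E; last first.
  exact/esym/(@fubini_tonelli1 _ _ _ _ _ S mu _ mUz (fun w => U0' s _)).
apply: (eq_sphere_integral ltr01).
- apply: measurableT_comp; first exact: (measurable_axis_integral v E
  (measurable_EFinT meas_u) Eu0).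
  by apply: measurable_scale_rV; [exact: measurable_cst|exact: measurable_id].
- by move=> x; exact: axis_integral_ge0.
- exact: (@measurable_fun_fubini_tonelli_F _ _ _ _ _ mu _ mUz (fun w =>
  U0' s _)).
- by move=> x; apply: integral_ge0 => y _; rewrite lee_fin.
- move=> x x1; apply: eq_integral => t _.
  by rewrite /U/= indic_unit x1 eqxx mul1r.
Qed.

(** Phi and Psi are continuous and have equal integrals against every test function, so
    [ge0_integral_test_eq] applies in both directions. Finiteness is kept because the transforms are
    [fine] of differences of such integrals. *)
Lemma hyperplane_average_shell (s : R) :
  hyperplane_average E (EFin \o u) s = shell_integral v E (EFin \o u) s /\
  (hyperplane_average E (EFin \o u) s < +oo)%E.
Proof.
have [p cp pE] := hyperplane_average_continuous.
have [q cq qE] := shell_integral_continuous.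
have mEu : measurable_fun setT (EFin \o u) by exact/measurable_EFinP.
have p0 x : 0 <= p x by rewrite -lee_fin -pE; exact: hyperplane_average_ge0.
have q0 x : 0 <= q x.
  rewrite -lee_fin -qE; apply: integral_ge0 => z _.
  exact: sphere_axis_integral_ge0.
have W (phi : R -> \bar R) : measurable_fun setT phi ->
  (forall s, 0 <= phi s)%E ->
    (\int[mu]_s (phi s * (p s)%:E) = \int[mu]_s (phi s * (q s)%:E))%E.
  move=> mphi phi0; under eq_integral do rewrite -pE.
  under [RHS]eq_integral do rewrite -qE.
  exact: (integral_average_shell v1 vE mEu Eu0 mphi phi0).
split; last by rewrite pE ltry.
rewrite pE qE; congr EFin; apply/eqP; rewrite eq_le.
apply/andP; split; first exact: (ge0_integral_test_eq p0 q0 cp cq W).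
apply: (ge0_integral_test_eq q0 p0 cq cp) => phi mphi phi0.
exact/esym/W.
Qed.

End gaussian_decay.

(** * The substitution r^2 = s^2 + rho^2 *)

Section squaring.
Local Open Scope ereal_scope.
Context {R : realType}.
Local Notation mu := (@lebesgue_measure R).

(* The density 2 t is the length of the fibre over t of a planar region, so that
   t^2 pushes forward the area of that region. *)
Let region : set (R * R) := [set z | (0 < z.1)%R && (0 <= z.2 <= 2 * z.1)%R].

Let indic_region (z : R * R) : \1_region z =
  (\1_(`]0%R, +oo[%classic : set R) z.1 * \1_(`[0%R,
    (2 * z.1)%R]%classic : set R) z.2)%R :> R.
Proof.
rewrite indicE indic_gt0 indicE -natrM mulnb; congr (nat_of_bool _)%:R%R.
apply/idP/idP => [|/andP[z1]]; rewrite !inE.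
  by case/andP => -> z2; rewrite inE /= in_itv.
by rewrite /= in_itv /region /= z1.
Qed.

Let measurable_region : measurable region.
Proof.
have -> : region = (fun z : R * R => z.1) @^-1` `]0%R, +oo[ `&`
   ((fun z : R * R => z.2) @^-1` `[0%R, +oo[ `&`
    (fun z : R * R => 2 * z.1 - z.2)%R @^-1` `[0%R, +oo[).
  apply/seteqP; split => z; rewrite /region /= !in_itv/= !andbT subr_ge0.
    by case/and3P.
  by case=> -> [-> ->].
have m1 : measurable_fun setT (fun z : R * R => z.1) by exact: measurable_fst.
have m2 : measurable_fun setT (fun z : R * R => z.2) by exact: measurable_snd.
by apply: measurableI; [|apply: measurableI]; rewrite -[X in measurable X]setTI;
  [apply: m1|apply: m2|apply: measurable_funB => //; exact: measurable_funM].
Qed.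

Let measurable_sqr1 : measurable_fun setT
  (fun z : measurableTypeR R * measurableTypeR R =>
    (z.1 ^+ 2)%R : measurableTypeR R).
Proof. by apply: measurable_funX; exact: measurable_fst. Qed.

Let P := pushforward_measure
  [the measure _ _ of mrestr [the measure _ _ of mu \x mu] measurable_region]
  measurable_sqr1.

Let integralP (W : R -> \bar R) : measurable_fun setT W ->
  (forall x, 0 <= W x) ->
  \int[P]_x W x = \int[mu]_(t in `]0%R, +oo[) (W (t ^+ 2)%R * (2 * t)%:E).
Proof.
move=> mW W0.
have mWs : measurable_fun setT (fun z : measurableTypeR R * measurableTypeR R
  => W (z.1 ^+ 2)%R).
  exact: (measurableT_comp mW measurable_sqr1).
have := ge0_integral_pushforward measurable_sqr1
  [the measure _ _ of mrestr [the measure _ _ of mu \x mu] measurable_region]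
  measurableT mW (fun x _ => W0 x).
rewrite preimage_setT => H; apply: (eq_trans H).
rewrite ge0_integral_mrestr; last 2 first.
- exact: mWs.
- by move=> x; exact: W0.
rewrite integral_indicM.
pose F (z : measurableTypeR R * measurableTypeR R) :=
  (\1_region z)%:E * W (z.1 ^+ 2)%R.
have mF : measurable_fun setT F.
  by apply: emeasurable_funM => //; apply: measurable_EFinT;
    exact: measurable_indic.
have F0 z : 0 <= F z by rewrite mule_ge0// lee_fin.
transitivity (\int[mu]_x \int[mu]_y F (x, y)).
  exact: (@fubini_tonelli1 _ _ _ _ _ mu mu F mF F0).
rewrite [RHS]integral_indicM; apply: eq_integral => t _; rewrite /F.
transitivity (\int[mu]_y ((\1_(`[0%R, (2 * t)%R]%classic : set R) y)%:E *
    ((\1_(`]0%R, +oo[%classic : set R) t)%:E * W (t ^+ 2)%R))).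
  by apply: eq_integral => y _; rewrite indic_region/= muleA -EFinM mulrC.
rewrite ge0_integralZr//; last 2 first.
- exact/measurable_EFinT/measurable_indic.
- by rewrite mule_ge0// lee_fin indicE.
have -> : \int[mu]_y (\1_(`[0%R, (2 * t)%R]%classic : set R) y)%:E =
    mu (`[0%R, (2 * t)%R]%classic : set R) by rewrite integral_indic// setIT.
rewrite lebesgue_measure_itv/= lte_fin indic_gt0 pmulr_rgt0//.
case: (ltP 0%R t) => t0; last by rewrite !mul0e.
by rewrite sube0 !mul1e muleC.
Qed.

Let integral_double (a b : R) : (a <= b)%R ->
  \int[mu]_(t in `]a, b]) (2 * t)%:E = (b ^+ 2 - a ^+ 2)%:E.
Proof.
rewrite le_eqVlt => /predU1P[<-|ab].
  by rewrite subrr set_itvoc0 integral_set0.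
have D (x : R) : is_derive x 1%R (fun t : R => t ^+ 2)%R (2 * x)%R.
  have := is_deriveX 2 (is_derive_id x 1%R).
  by rewrite /GRing.scale/= expr1 mulr1.
have C : continuous (fun t : R => t ^+ 2)%R by exact: exprn_continuous.
rewrite integral_itv_obnd_cbnd; last first.
  by apply/measurable_funTS/measurable_EFinT; exact: measurable_funM.
rewrite (@continuous_FTC2 _ (fun t => 2 * t)%R (fun t => t ^+ 2)%R _ _ ab)//.
- apply: continuous_subspaceT => x; apply: cvgM; [exact: cvg_cst|exact: cvg_id].
- split.
  + by move=> x _; have [] := D x.
  + by apply: cvg_at_right_filter; exact: C.
  + by apply: cvg_at_left_filter; exact: C.
- by move=> x _; rewrite derive1E; have := D x => Dx; rewrite derive_val.
Qed.

(** [Num.sqrt] is 0 on negative reals, so the formula also covers intervals reaching below 0, where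
    P has no mass. *)
Let P_ocitv (a b : R) : (a <= b)%R ->
  P `]a, b]%classic = (Num.sqrt b ^+ 2 - Num.sqrt a ^+ 2)%:E.
Proof.
move=> ab; have mI : measurable (`]a, b]%classic : set R) by [].
rewrite -[LHS]mul1e -[X in X * _]/(1%:E) -integral_cst//
  -[LHS]/(\int[P]_(x in `]a, b]) 1%:E).
rewrite integral_indicM; under eq_integral do rewrite mule1.
rewrite integralP; last 2 first.
- exact/measurable_EFinT/measurable_indic.
- by move=> x; rewrite lee_fin.
have sab : (Num.sqrt a <= Num.sqrt b)%R by exact: ler_wsqrtr.
transitivity (\int[mu]_(t in `]Num.sqrt a, Num.sqrt b]) (2 * t)%:E).
  rewrite integral_indicM [RHS]integral_indicM; apply: eq_integral => t _.
  rewrite indic_gt0 !indicE !mem_setE !in_itv/=.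
  case: (ltP 0%R t) => t0; last first.
    by rewrite mul0e ltNge (le_trans t0 (sqrtr_ge0 _)) mul0e.
  have t2 : (0 < t ^+ 2)%R by rewrite exprn_gt0.
  have lt_sq c : (c < t ^+ 2)%R = (Num.sqrt c < t)%R.
    by rewrite -(ltr_sqrt _ t2) sqrtr_sqr gtr0_norm.
  by rewrite mul1e leNgt !lt_sq -leNgt.
exact: integral_double.
Qed.

(** P only charges the positive half-line. Adding Lebesgue measure on ]-oo, 0] gives a measure on
    the whole line, to which uniqueness of Lebesgue measure applies. *)
Let P_add (X : set R) : ocitv X ->
  mu X = measure_add P [the measure _ _ of mrestr mu (measurable_itv `]-oo,
    0%R])] X.
Proof.
move=> [[a b] _ <-] /=; rewrite measure_addE.
change (mu `]a, b]%classic = P `]a, b]%classic + mu (`]a, b]%classic `&` `]-oo,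
  0%R]%classic)).
have [ab|ba] := leP a b; last first.
  by rewrite set_itv_ge ?bnd_simp -?leNgt ?ltW// set0I !measure0 adde0.
rewrite P_ocitv//.
have -> : `]a, b]%classic `&` `]-oo, 0%R]%classic = `]a, Num.min b 0%R]%classic.
  apply/seteqP; split => x /=; rewrite !in_itv/= le_min.
    by case=> /andP[-> ->] ->.
  by case/and3P => -> -> ->.
have sq c : (Num.sqrt c ^+ 2)%R = if (0 <= c)%R then c else 0%R.
  by case: ifPn => [/sqr_sqrtr//|]; rewrite -ltNge => /ltW/ler0_sqrtr ->;
    rewrite expr0n.
rewrite !lebesgue_measure_itv/= !lte_fin !sq.
have [a0|a0] := leP 0%R a; have [b0|b0] := leP 0%R b.
- rewrite [(a < 0)%R]ltNge a0/= adde0; case: ltP => // ba.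
  by rewrite (@le_anti _ _ a b) ?subrr// ab.
- by have := lt_le_trans b0 (le_trans a0 ab); rewrite ltxx.
- by rewrite a0 (lt_le_trans a0 b0) -!EFinB -EFinD; congr EFin; ring.
- by rewrite subr0 add0e.
Qed.

(** On ]0, +oo[ the measure P is Lebesgue measure. Arguing with measures lets W be any nonnegative
    measurable function, possibly unbounded near 0, as happens below for n = 3. *)
Lemma ge0_integral_square (W : R -> \bar R) : measurable_fun setT W ->
  (forall x, 0 <= W x) ->
  \int[mu]_(x in `]0%R, +oo[) W x =
  \int[mu]_(t in `]0%R, +oo[) (W (t ^+ 2)%R * (2 * t)%:E).
Proof.
move=> mW W0; transitivity (\int[P]_(x in `]0%R, +oo[) W x).
  apply: eq_measure_integral => A mA A0.
  apply: (eq_trans (lebesgue_measure_unique P_add mA)).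
  apply: (eq_trans (measure_addE _ _ A)).
  rewrite [X in _ + X](_ : _ = 0) ?adde0//.
  change (mu (A `&` `]-oo, 0%R]%classic) = 0).
  rewrite (_ : _ `&` _ = set0) ?measure0//.
  apply/seteqP; split => // x [/A0] /=; rewrite !in_itv/= andbT => x0.
  by rewrite leNgt x0.
rewrite integral_indicM integralP; last 2 first.
- by apply: emeasurable_funM mW; exact/measurable_EFinT/measurable_indic.
- by move=> x; rewrite mule_ge0// lee_fin.
apply: eq_integral => t; rewrite inE/= in_itv/= andbT => t0.
by rewrite indic_gt0 exprn_gt0// mul1e.
Qed.

End squaring.

Section shell_kernel.
Local Open Scope ereal_scope.
Context {R : realType}.
Local Notation mu := (@lebesgue_measure R).

Lemma sphere_areaE k : @sphere_measure R k.+1 1%R setT = (sphere_area R k)%:E.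
Proof. by rewrite fineK//; exact: sphere_measure_fin_num. Qed.

(** With n = k.+3 the exponent (n - 4)/2 is (k - 1)/2: a half-integer for even k and negative for k
    = 0, hence the real power. *)
Lemma powR_sqr_half (k : nat) (t : R) : (0 < t)%R ->
  ((t ^+ 2) `^ ((k.+3%:R - 4) / 2) * t = t ^+ k)%R.
Proof.
move=> t0; rewrite -(powR_mulrn 2 (ltW t0)) -powRrM -[X in (_ * X)%R](powRr1
  (ltW t0)).
rewrite -powRD; last by rewrite (gt_eqF t0) implybT.
rewrite -(powR_mulrn k (ltW t0)); congr (_ `^ _)%R.
by rewrite -addn3 natrD; field.
Qed.

(** After polar coordinates, t -> r with r^2 = t^2 + s^2 is split into squaring, translation by s^2,
    and squaring read backwards. The factor [r ^+ k.+1] is r^(n-2), to be absorbed by the cylinder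
    integral. *)
Lemma integral_shell (k : nat) (s : R) (A : R -> \bar R) : (0 <= s)%R ->
  measurable_fun setT A -> (forall r, 0 <= A r) ->
  \int[lebesgue_rV R k.+1]_z A (norm2 (cons_rV (s, z))) =
  \int[mu]_(r in `]s, +oo[) (A r * (r ^+ k.+1 * kernel_g k.+3 s r)%:E).
Proof.
move=> s0 mA A0.
have mN : measurable_fun setT (fun z : 'rV[R]_k.+1 =>
  A (norm2 (cons_rV (s, z)))).
  apply: (measurableT_comp mA); apply: (measurableT_comp (@measurable_norm2 R
    k.+2)).
  exact: (measurableT_comp (@measurable_cons_rV R k.+1) (pair1_measurable s)).
rewrite (ge0_integral_polar mN (fun z => A0 _)).
have ar0 : (0 <= sphere_area R k)%R by rewrite -lee_fin -sphere_areaE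
  measure_ge0.
set p : R := ((k.+3%:R - 4) / 2)%R.
(* The 1/2 anticipates the density 2 t: W(t^2) 2 t is the polar integrand, since (t^2)^p t = t^k. *)
pose W y := (sphere_area R k * (y `^ p / 2))%:E * A (Num.sqrt (y + s ^+ 2))%R.
have mW : measurable_fun setT W.
  apply: emeasurable_funM.
    by apply: measurable_EFinT; apply: measurable_funM => //;
      exact: measurable_funM.
  apply: (measurableT_comp mA); apply: measurableT_comp.
    by apply: continuous_measurable_fun; exact: sqrt_continuous.
  exact: measurable_funD.
have W0 y : 0 <= W y by rewrite mule_ge0// lee_fin mulr_ge0// divr_ge0//
  powR_ge0.
transitivity (\int[mu]_(t in `]0%R, +oo[) (W (t ^+ 2)%R * (2 * t)%:E)).
  apply: eq_integral => t; rewrite inE/= in_itv/= andbT => t0.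
  transitivity ((t ^+ k)%:E * \int[@sphere_measure R k.+1 1%R]_x cst (A
    (Num.sqrt (t ^+ 2 + s ^+ 2))%R) x).
    congr (_ * _); apply: (eq_sphere_integral ltr01) => //.
    - by apply: (measurableT_comp mN); apply: measurable_scale_rV => //;
      exact: measurable_id.
    - by move=> x; exact: A0.
    - move=> x x1; rewrite /norm2 dot_cons/= dotZl dotZr -sqr_norm2 x1 /cst.
      by congr (A (Num.sqrt _)); ring.
  rewrite integral_cst//; set a := A _.
  rewrite (_ : a * _ = a * (sphere_area R k)%:E); last by congr (_ * _);
    exact: sphere_areaE.
  rewrite /W -/a muleAC -EFinM muleCA -!EFinM -(powR_sqr_half k t0) -/p.
  by rewrite muleC; congr (_%:E * _); field.
rewrite -(ge0_integral_square mW W0) integral_indicM.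
rewrite -(ge0_integral_shift (- s ^+ 2)%R); last 2 first.
- by apply: emeasurable_funM mW; exact/measurable_EFinT/measurable_indic.
- by move=> x; rewrite mule_ge0// lee_fin.
pose V x := (\1_(`]0%R, +oo[%classic : set R) (x - s ^+ 2)%R)%:E * W (x - s ^+
  2)%R.
have mV : measurable_fun setT V.
  have ms : measurable_fun setT (fun x : R =>
    (x - s ^+ 2)%R) by exact: measurable_funB.
  apply: emeasurable_funM; last exact: (measurableT_comp mW ms).
  by apply: measurable_EFinT; apply: measurableT_comp ms;
    exact: measurable_indic.
have V0 x : 0 <= V x by rewrite mule_ge0// lee_fin.
transitivity (\int[mu]_(x in `]0%R, +oo[) V x).
  rewrite [RHS]integral_indicM; apply: eq_integral => x _;
    rewrite /V !indic_gt0.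
  case: (ltP 0%R (x - s ^+ 2)%R) => xs; last by rewrite !mul0e mule0.
  have x0 : (0 < x)%R by rewrite (le_lt_trans (sqr_ge0 s))// -subr_gt0.
  by rewrite x0 !mul1e.
rewrite (ge0_integral_square mV V0) integral_indicM [RHS]integral_indicM.
apply: eq_integral => r _; rewrite /V !indic_gt0 indicE mem_setE in_itv/= andbT
  subr_gt0.
case: (ltP 0%R r) => r0; last by rewrite mul0e ltNge (le_trans r0 s0) mul0e.
rewrite ltr_sqr ?nnegrE// 1?ltW//.
case: (ltP s r) => sr; last by rewrite !mul0e mule0.
rewrite !mul1e /W subrK sqrtr_sqr gtr0_norm// muleAC -EFinM muleC;
  congr (_ * _%:E).
rewrite /kernel_g -/p (_ : (k.+3 - 3 = k)%N); last by rewrite !subSS subn0.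
by rewrite [(r ^+ k.+1)%R]exprS; field; rewrite expf_neq0// gt_eqF.
Qed.
End shell_kernel.

(** * The transforms as iterated integrals *)

Section transforms_as_integrals.
Local Open Scope ereal_scope.
Context {R : realType}.
Local Notation mu := (@lebesgue_measure R).

Lemma frame_completeness m (w : 'rV[R]_m.+1) (F : 'M[R]_(m, m.+1)) :
  norm2 w = 1%R -> is_perp_frame w F -> (w^T *m w + F^T *m F)%R = 1%:M.
Proof.
move=> w1 wF; rewrite -(mulmx1C (frame_mx_orthogonal w1 wF)) /frame_mx.
by rewrite (@tr_col_mx _ 1 m) (@mul_row_col _ _ 1 m).
Qed.

(** Two frames of the same hyperplane differ by the orthogonal matrix [F1 *m F2^T], so independence
    of the frame is orthogonal invariance in R^m. *)
Lemma ge0_integral_frame m (w : 'rV[R]_m.+1) (F1 F2 : 'M[R]_(m, m.+1)) c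
    (g : 'rV[R]_m.+1 -> \bar R) :
  norm2 w = 1%R -> is_perp_frame w F1 -> is_perp_frame w F2 ->
  measurable_fun setT g -> (forall x, 0 <= g x) ->
  \int[lebesgue_rV R m]_y g (c + y *m F1)%R = \int[lebesgue_rV R m]_y g (c + y
    *m F2)%R.
Proof.
move=> w1 wF1 wF2 mg g0; have C := frame_completeness w1 wF2.
case: wF1 => F11 F1w.
have OE : F1 *m F2^T *m F2 = F1.
  by rewrite -mulmxA -[RHS]mulmx1 -C mulmxDr [F1 *m (w^T *m w)]mulmxA F1w
    mul0mx add0r.
have OO : (F1 *m F2^T) *m (F1 *m F2^T)^T = 1%:M.
  by rewrite trmx_mul trmxK mulmxA OE F11.
rewrite -[RHS](ge0_integral_orthogonal OO); last 2 first.
- apply: measurableT_comp mg _; apply: measurable_addrV;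
  first exact: measurable_cst.
  by apply: measurable_mulmx_rV; exact: measurable_id.
- by move=> x; exact: g0.
by apply: eq_integral => y _; rewrite -(mulmxA y) OE.
Qed.

Lemma measurable_hyperplane_set m (w : 'rV[R]_m.+1)
  s : measurable (hyperplane w s).
Proof.
rewrite (_ : hyperplane w s = setT `&` (fun x => dot x w) @^-1` [set s]);
  last by rewrite setTI.
exact: measurable_dot.
Qed.

Lemma ge0_integral_hyperplane m (w : 'rV[R]_m.+1) s (F : 'M[R]_(m, m.+1))
    (g : 'rV[R]_m.+1 -> \bar R) :
  norm2 w = 1%R -> is_perp_frame w F ->
  measurable_fun setT g -> (forall x, 0 <= g x) ->
  \int[hyperplane_measure w s]_(x in hyperplane w s) g x =
  \int[lebesgue_rV R m]_y g (s *: w + y *m F)%R.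
Proof.
move=> w1 wF mg g0; have wP := perp_frameP w1.
rewrite -(ge0_integral_frame _ w1 wP wF mg g0).
have mh : measurable_fun setT (fun y : 'rV[R]_m =>
  s *: w + y *m perp_frame w)%R.
  apply: measurable_addrV; first exact: measurable_cst.
  by apply: measurable_mulmx_rV; exact: measurable_id.
have := ge0_integral_pushforward mh (lebesgue_rV R m)
  (measurable_hyperplane_set w s)
  (measurable_funTS mg) (fun x _ => g0 x).
have -> : (fun y : 'rV[R]_m => s *: w + y *m perp_frame w)%R @^-1` hyperplane w
  s = setT.
  apply/seteqP; split => // y _; rewrite /hyperplane /= dotDl dotZl -sqr_norm2
    w1 expr1n mulr1.
  by case: wP => _ Fw; rewrite /dot -mulmxA Fw mulmx0 mxE addr0.
exact.
Qed.

Lemma measurable_cylinder_set m (v p : 'rV[R]_m.+1)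
  r : measurable (cylinder v p r).
Proof.
rewrite (_ : cylinder v p r = setT `&`
    (fun y => norm2 (y - p) ^+ 2 - dot v (y - p) ^+ 2)%R @^-1` [set (r ^+
      2)%R]); last by rewrite setTI.
have md : measurable_fun setT (fun y : 'rV[R]_m.+1 => y - p)%R.
  by apply: measurable_subrV; [exact: measurable_id|exact: measurable_cst].
apply: measurable_funB => //; apply: measurable_funX.
  exact: (measurableT_comp (@measurable_norm2 R m.+1) md).
by apply: measurable_dot => //; exact: measurable_cst.
Qed.

(** By orthogonality, p + t v + x [perp_frame v] is on the cylinder as soon as |x| = r, so the
    indicator of the cylinder is removed through [eq_sphere_integral]. *)
Lemma ge0_integral_cylinder m (v p : 'rV[R]_m.+1) r (g : 'rV[R]_m.+1 ->
  \bar R) :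
  (0 < r)%R -> norm2 v = 1%R ->
  measurable_fun setT g -> (forall x, 0 <= g x) ->
  \int[cylinder_measure v p r]_(y in cylinder v p r) g y =
  \int[@sphere_measure R m r]_x \int[mu]_t g (p + t *: v + x *m perp_frame v)%R.
Proof.
move=> r0 v1 mg g0; have [EE Ev] := perp_frameP v1.
have mD := measurable_cylinder_set v p r.
have mh : measurable_fun setT (fun z : 'rV[R]_m * measurableTypeR R =>
    p + z.2 *: v + z.1 *m perp_frame v)%R.
  apply: measurable_addrV; last by apply: measurable_mulmx_rV;
    exact: measurable_fst.
  apply: measurable_addrV; first exact: measurable_cst.
  by apply: measurable_scalerV; exact: measurable_snd.
rewrite integral_indicM.
pose G y := (\1_(cylinder v p r) y)%:E * g y.
have mG : measurable_fun setT G.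
  by apply: emeasurable_funM mg; exact/measurable_EFinT/measurable_indic.
have G0 y : 0 <= G y by rewrite mule_ge0// lee_fin indicE.
pose S := @sphere_measure R m r.
have := ge0_integral_pushforward mh [the measure _ _ of (S \x mu)%E]
  measurableT mG (fun x _ => G0 x).
rewrite preimage_setT => H; apply: (eq_trans H).
have mGh := measurableT_comp mG mh.
transitivity (\int[S]_x \int[mu]_t G (p + t *: v + x *m perp_frame v)%R).
  by apply: (@fubini_tonelli1 _ _ _ _ _ S mu _ mGh) => z; exact: G0.
apply: (eq_sphere_integral r0).
- exact: (@measurable_fun_fubini_tonelli_F _ _ _ _ _ mu _ mGh (fun z => G0 _)).
- by move=> x; exact: integral_ge0.
- exact: (@measurable_fun_fubini_tonelli_F _ _ _ _ _ mu _ (measurableT_comp mg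
  mh) (fun z => g0 _)).
- by move=> x; exact: integral_ge0.
- move=> x xr; apply: eq_integral => t _; rewrite /G indicE mem_set ?mul1e//.
  have vF : dot v (x *m perp_frame v) = 0%R by rewrite dotC /dot -mulmxA Ev
    mulmx0 mxE.
  rewrite /cylinder /=.
  have -> : (p + t *: v + x *m perp_frame v - p = t *: v + x *m perp_frame v)%R.
    by rewrite -(addrA p) [(p + _)%R]addrC addrK.
  rewrite sqr_norm2 !(dotDl, dotDr, dotZl, dotZr) dot_orthogonal//.
  rewrite (dotC _ v) vF -!sqr_norm2 v1 xr; ring.
Qed.

End transforms_as_integrals.

(** * Signed functions and translations *)

Section signed.
Context {R : realType}.
Local Notation mu := (@lebesgue_measure R).

(** Real-valued, so that continuity and Gaussian bounds can be stated for it; the negative part is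
    [pos_part (-%R \o f)]. *)
Definition pos_part n (f : 'rV[R]_n -> R) : 'rV[R]_n -> R := fun x =>
  Num.max (f x) 0.

Lemma pos_part_ge0 n (f : 'rV[R]_n -> R) x : 0 <= pos_part f x.
Proof. by rewrite le_max lexx orbT. Qed.

Lemma measurable_pos_part n (f : 'rV[R]_n -> R) :
  measurable_fun setT f -> measurable_fun setT (pos_part f).
Proof. by move=> mf; exact: measurable_maxr. Qed.

Lemma integral_pos_part n (P : {measure set 'rV[R]_n ->
  \bar R}) D (f : 'rV[R]_n -> R) :
  (\int[P]_(x in D) (f x)%:E = \int[P]_(x in D) (pos_part f x)%:E -
     \int[P]_(x in D) (pos_part (-%R \o f) x)%:E)%E.
Proof.
rewrite integralE; congr (_ - _)%E; apply: eq_integral => x _.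
  by rewrite funeposE EFin_max.
by rewrite funenegE EFin_max.
Qed.

Variables (m : nat) (f : 'rV[R]_m.+1 -> R).
Hypothesis mf : measurable_fun setT f.

Let mfp : measurable_fun setT (EFin \o pos_part f).
Proof. exact: (measurable_EFinT (measurable_pos_part mf)). Qed.

Let mfn : measurable_fun setT (EFin \o pos_part (-%R \o f)).
Proof.
by apply: (measurable_EFinT (measurable_pos_part _)); exact: measurableT_comp.
Qed.

Lemma RadonE (w : 'rV[R]_m.+1) s (F : 'M[R]_(m, m.+1)) :
  norm2 w = 1 -> is_perp_frame w F ->
  Radon f w s = fine (\int[lebesgue_rV R m]_y (pos_part f (s *: w + y *m F))%:E
    -
    \int[lebesgue_rV R m]_y (pos_part (-%R \o f) (s *: w + y *m F))%:E)%E.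
Proof.
move=> w1 wF; rewrite /Radon /Rintegral integral_pos_part;
  congr (fine (_ - _)%E).
  by rewrite (ge0_integral_hyperplane s w1 wF mfp)// => x;
    rewrite lee_fin pos_part_ge0.
by rewrite (ge0_integral_hyperplane s w1 wF mfn)// => x;
  rewrite lee_fin pos_part_ge0.
Qed.

Lemma cylindrical_RadonE (v p : 'rV[R]_m.+1) r : 0 < r -> norm2 v = 1 ->
  cylindrical_Radon f v p r =
  fine (\int[@sphere_measure R m r]_x \int[mu]_t
            (pos_part f (p + t *: v + x *m perp_frame v))%:E -
        \int[@sphere_measure R m r]_x \int[mu]_t
            (pos_part (-%R \o f) (p + t *: v + x *m perp_frame v))%:E)%E.
Proof.
move=> r0 v1; rewrite /cylindrical_Radon /Rintegral integral_pos_part;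
  congr (fine (_ - _)%E).
  by rewrite (ge0_integral_cylinder p r0 v1 mfp)// => x;
    rewrite lee_fin pos_part_ge0.
by rewrite (ge0_integral_cylinder p r0 v1 mfn)// => x;
  rewrite lee_fin pos_part_ge0.
Qed.

Lemma measurable_translate (p : 'rV[R]_m.+1) : measurable_fun setT (translate p
  f).
Proof. exact: (measurableT_comp mf (measurable_addl_rV p)). Qed.

End signed.

Section translation.
Context {R : realType} (m : nat).

Lemma frame_decomposition (w x : 'rV[R]_m.+1) (F : 'M[R]_(m, m.+1)) :
  norm2 w = 1 -> is_perp_frame w F -> dot x w *: w + x *m F^T *m F = x.
Proof.
move=> w1 wF; rewrite -[RHS]mulmx1 -(frame_completeness w1 wF) mulmxDr !mulmxA.
by rewrite [x *m w^T]mx11_scalar mul_scalar_mx.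
Qed.

(** The component of p along w shifts the level s; the component inside the hyperplane is absorbed
    by translation invariance there. *)
Lemma Radon_translate (f : 'rV[R]_m.+1 -> R) (w p : 'rV[R]_m.+1) s :
  measurable_fun setT f -> norm2 w = 1 ->
  Radon f w (s + dot w p) = Radon (translate p f) w s.
Proof.
move=> mf w1; have wH := householderP w1.
rewrite (RadonE mf _ w1 wH) (RadonE (measurable_translate mf p) _ w1 wH).
have shift (g : 'rV[R]_m.+1 -> R) : measurable_fun setT g ->
  (forall x, 0 <= g x) ->
    (\int[lebesgue_rV R m]_y (g ((s + dot w p) *: w + y *m householder w))%:E =
     \int[lebesgue_rV R m]_y (g (s *: w + y *m householder w + p))%:E)%E.
  move=> mg g0; rewrite -[LHS](ge0_integral_rV_shift (p *m (householder w)^T));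
    last 2 first.
  - apply: measurable_EFinT; apply: (measurableT_comp mg);
    apply: measurable_addrV.
      exact: measurable_cst.
    by apply: measurable_mulmx_rV; exact: measurable_id.
  - by move=> x; rewrite lee_fin.
  apply: eq_integral => y _; congr (g _)%:E.
  rewrite -[p in RHS](frame_decomposition _ w1 wH) mulmxDl scalerDl (dotC p w).
  by rewrite addrACA.
by congr (fine (_ - _)%E); rewrite shift//; [exact: measurable_pos_part|exact:
  pos_part_ge0|
  apply: measurable_pos_part; exact: measurableT_comp|exact: pos_part_ge0].
Qed.

End translation.

(** * Nonnegative functions with Gaussian decay *)

Section nonnegative_case.
Context {R : realType} (k : nat).
Local Notation mu := (@lebesgue_measure R).
Local Notation S := (@sphere_measure R k.+2 1).
Variables (v : 'rV[R]_k.+3) (E : 'M[R]_(k.+2, k.+3)).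
Hypotheses (v1 : norm2 v = 1) (vE : is_perp_frame v E).
Variables (u : 'rV[R]_k.+3 -> R) (K : R).
Hypotheses (cu : continuous u) (u0 : forall x, 0 <= u x)
  (uK : forall x, u x <= K * gauss x).

Let mEu : measurable_fun setT (EFin \o u) :=
  measurable_EFinT (continuous_measurable_rV cu).

Let Eu0 x : (0 <= (EFin \o u) x)%E. Proof. by rewrite lee_fin. Qed.

Let K0 : 0 <= K.
Proof. by have := le_trans (u0 0) (uK 0); rewrite pmulr_lge0// expR_gt0. Qed.

(** For unit w, the Radon transform of a nonnegative u before [fine] is applied, in the frame that
    is measurable in w. *)
Definition plane_integral (s : R) (w : 'rV[R]_k.+3) : \bar R :=
  (\int[lebesgue_rV R k.+2]_y (u (s *: w + y *m householder w))%:E)%E.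

Lemma plane_integral_ge0 s w : (0 <= plane_integral s w)%E.
Proof. by apply: integral_ge0 => y _; rewrite lee_fin. Qed.

Lemma measurable_plane_integral_dir s : measurable_fun setT (plane_integral s).
Proof.
apply: (measurable_fun_fubini_tonelli_F (fun z : 'rV[R]_k.+3 * 'rV[R]_k.+2 =>
  (u (s *: z.1 + z.2 *m householder z.1))%:E)).
  apply: (measurableT_comp mEu); apply: measurable_addrV.
    by apply: measurable_scale_rV; [exact: measurable_cst|exact:
      measurable_fst].
  by apply: measurable_householder; [exact: measurable_fst|exact:
    measurable_snd].
by move=> z; rewrite lee_fin.
Qed.

Lemma plane_integral_fin_num s w : norm2 w = 1 ->
  plane_integral s w \is a fin_num.
Proof.
move=> w1; rewrite ge0_fin_numE ?plane_integral_ge0//.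
have [c c0 cE] := @integral_gauss R k.+2.
apply: (@le_lt_trans _ _ (\int[lebesgue_rV R k.+2]_y (K%:E * (gauss y)%:E))%E);
  last first.
  rewrite ge0_integralZl_EFin//.
  - by rewrite cE ltry.
  - by move=> x _; rewrite lee_fin gauss_ge0.
  - exact: (measurable_EFinT (@measurable_gauss R k.+2)).
apply: ge0_le_integral.
- exact: measurableT.
- by move=> y _; rewrite lee_fin.
- apply: (measurableT_comp mEu); apply: measurable_addrV;
  first exact: measurable_cst.
  by apply: measurable_mulmx_rV; exact: measurable_id.
- apply: emeasurable_funM; first exact: measurable_cst.
  exact: (measurable_EFinT (@measurable_gauss R k.+2)).
- move=> y _; rewrite -EFinM lee_fin (le_trans (uK _))// ler_wpM2l//.
  rewrite (gauss_frame _ _ w1 (householderP w1)) ler_piMl ?gauss_ge0//.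
  by rewrite -expR0 ler_expR oppr_le0 sqr_ge0.
Qed.

Lemma sphere_axis_integral_fin_num r :
  sphere_axis_integral v E (EFin \o u) r \is a fin_num.
Proof.
rewrite ge0_fin_numE ?sphere_axis_integral_ge0//.
have bound y : (axis_integral v E (EFin \o u) y <= (K * Num.sqrt pi)%:E)%E.
  rewrite EFinM -integralT_gauss -ge0_integralZl_EFin//; last 2 first.
  - by move=> x _; rewrite lee_fin gauss_fun_ge0.
  - exact: (measurable_EFinT measurable_gauss_fun).
  apply: ge0_le_integral => //.
  - apply: (measurableT_comp mEu); apply: measurable_addrV;
    last exact: measurable_cst.
    exact: measurable_scalerV.
  - apply: emeasurable_funM; first exact: measurable_cst.
    exact: (measurable_EFinT measurable_gauss_fun).
  - move=> t _; rewrite -EFinM lee_fin (le_trans (uK _))// ler_wpM2l//.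
    rewrite (gauss_frame _ _ v1 vE) ler_piMr ?expR_ge0//.
    by rewrite -expR0 ler_expR oppr_le0 dot_ge0.
apply: (@le_lt_trans _ _ (\int[S]_x cst (K * Num.sqrt pi)%:E x)%E).
  apply: ge0_le_integral => //.
  - by move=> x _; exact: axis_integral_ge0.
  - apply: measurableT_comp; first exact: (measurable_axis_integral v E mEu
    Eu0).
    by apply: measurable_scale_rV; [exact: measurable_cst|exact: measurable_id].
rewrite integral_cst// lte_mul_pinfty ?lee_fin ?mulr_ge0 ?sqrtr_ge0//.
have := @sphere_measure_fin_num R k.+2 1 setT measurableT.
by rewrite ge0_fin_numE.
Qed.

Lemma integral_sphere_axis_kernel (s : R) : 0 <= s ->
  (\int[mu]_(r in `]s, +oo[) (sphere_axis_integral v E (EFin \o u) r *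
      (r ^+ k.+1 * kernel_g k.+3 s r)%:E) = hyperplane_average E (EFin \o u)
        s)%E.
Proof.
move=> s0; have [-> _] := hyperplane_average_shell v1 vE cu u0 uK s.
rewrite -(integral_shell k s0 (measurable_sphere_axis_integral v E mEu Eu0))//.
by move=> r; exact: sphere_axis_integral_ge0.
Qed.

End nonnegative_case.

Lemma measurable_great_subsphere_set (R : realType) k (v : 'rV[R]_k.+1) :
  measurable (great_subsphere v).
Proof.
rewrite (_ : great_subsphere v = (@norm2 R k.+1 @^-1` [set 1]) `&` ((fun x =>
  dot x v) @^-1` [set 0]))//.
apply: measurableI; rewrite -[X in measurable X]setTI.
  exact: measurable_norm2.
exact: measurable_dot.
Qed.

Lemma ge0_integral_great_subsphere (R : realType) k (v : 'rV[R]_k.+2)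
    (g : 'rV[R]_k.+2 -> \bar R) : norm2 v = 1 ->
  measurable_fun setT g -> (forall x, 0 <= g x)%E ->
  (\int[great_subsphere_measure v]_(w in great_subsphere v) g w =
   \int[@sphere_measure R k.+1 1]_x g (x *m perp_frame v))%E.
Proof.
move=> v1 mg g0; have [EE Ev] := perp_frameP v1.
have mD := measurable_great_subsphere_set v.
have mh : measurable_fun setT (fun y : 'rV[R]_k.+1 => y *m perp_frame v).
  by apply: measurable_mulmx_rV; exact: measurable_id.
rewrite integral_indicM.
pose G y := ((\1_(great_subsphere v) y)%:E * g y)%E.
have mG : measurable_fun setT G.
  by apply: emeasurable_funM mg; exact/measurable_EFinT/measurable_indic.
have G0 y : (0 <= G y)%E by rewrite mule_ge0// lee_fin indicE.
have := ge0_integral_pushforward mh [the measure _ _ of @sphere_measure R k.+1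
  1] measurableT mG (fun x _ => G0 x).
rewrite preimage_setT => H; apply: (eq_trans H).
apply: (eq_sphere_integral ltr01).
- exact: (measurableT_comp mG mh).
- by move=> x; exact: G0.
- exact: (measurableT_comp mg mh).
- by move=> x; exact: g0.
- move=> x x1; rewrite /G /= indicE mem_set ?mul1e//.
  by split; [rewrite norm2_orthogonal|rewrite /dot -mulmxA Ev mulmx0 mxE].
Qed.

Section nonnegative_integrable.
Context {R : realType} (k : nat).
Local Notation mu := (@lebesgue_measure R).
Variables (v : 'rV[R]_k.+3) (E : 'M[R]_(k.+2, k.+3)).
Hypotheses (v1 : norm2 v = 1) (vE : perp_frame v = E).
Variables (u : 'rV[R]_k.+3 -> R) (K s : R).
Hypotheses (cu : continuous u) (u0 : forall x, 0 <= u x)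
  (uK : forall x, u x <= K * gauss x) (s0 : 0 <= s).

Let wE : is_perp_frame v E.
Proof. by rewrite -vE; exact: perp_frameP. Qed.

Let meas_u : measurable_fun setT u := continuous_measurable_rV cu.

Let mEu : measurable_fun setT (EFin \o u) := measurable_EFinT meas_u.

Let Eu0 x : (0 <= (EFin \o u) x)%E. Proof. by rewrite lee_fin. Qed.

Let A r := fine (sphere_axis_integral v E (EFin \o u) r).

Let A0 r : 0 <= A r.
Proof. by apply: fine_ge0; exact: sphere_axis_integral_ge0. Qed.

Let c r := r ^+ k.+1 * kernel_g k.+3 s r.

Let c_ge0 r : s < r -> 0 <= c r.
Proof.
move=> sr; have r0 := le_lt_trans s0 sr.
apply: mulr_ge0; first by apply: exprn_ge0; exact: ltW.
apply: mulr_ge0; first by apply: fine_ge0; exact: measure_ge0.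
by apply: divr_ge0; [exact: powR_ge0|apply: exprn_ge0; exact: ltW].
Qed.

Lemma integral_axis_kernel :
  (\int[mu]_(r in `]s, +oo[) (A r * c r)%:E = hyperplane_average E (EFin \o u)
    s)%E.
Proof.
rewrite -(integral_sphere_axis_kernel v1 wE cu u0 uK s0).
apply: eq_integral => r _; rewrite EFinM fineK//.
exact: (sphere_axis_integral_fin_num v1 wE cu u0 uK r).
Qed.

Lemma hyperplane_average_fin_num : hyperplane_average E (EFin \o u)
  s \is a fin_num.
Proof.
rewrite ge0_fin_numE; last exact: hyperplane_average_ge0.
by have [_ ->] := hyperplane_average_shell v1 wE cu u0 uK s.
Qed.

(** Integrability for each sign separately is what lets the integral of the difference be split. It
    follows from finiteness of [hyperplane_average], which already controls the kernel near r = s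
    and at infinity. *)
Lemma integrable_axis_kernel : mu.-integrable `]s, +oo[ (fun r =>
  (A r * c r)%:E).
Proof.
apply/integrableP; split.
  apply/measurable_EFinP; apply: measurable_funM.
    apply: measurable_funTS; apply: (measurableT_comp (fine_measurable
      measurableT)).
    exact: (measurable_sphere_axis_integral v E mEu Eu0).
  (* A variant of c measurable on the whole line by [measurable_ge0_inv]; the two agree for r >
     s. *)
  pose c' (r : R) : R := r ^+ k.+1 * (sphere_area R k *
      ((r ^+ 2 - s ^+ 2) `^ ((k.+3%:R - 4) / 2) * `|r ^+ k|^-1)).
  apply: (@eq_measurable_fun _ _ _ _ _ c').
    move=> r; rewrite inE/= in_itv/= andbT => sr; rewrite /c /kernel_g.
    rewrite (_ : (k.+3 - 3 = k)%N); last by rewrite !subSS subn0.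
    have rk : 0 <= r ^+ k by apply: exprn_ge0; exact: ltW (le_lt_trans s0 sr).
    by rewrite /c' ger0_norm.
  apply: measurable_funTS; apply: measurable_funM => //;
    apply: measurable_funM => //.
  apply: measurable_funM; last by apply: measurable_ge0_inv => //;
    exact: measurableT_comp.
  apply: (measurableT_comp (measurable_powR _)).
  by apply: measurable_funB => //; exact: measurable_funX.
rewrite (_ : \int[mu]_(r in _) _ = \int[mu]_(r in `]s, +oo[) (A r * c r)%:E)%E;
  last first.
  apply: eq_integral => r; rewrite inE/= in_itv/= andbT => sr.
  by rewrite ger0_norm// mulr_ge0// c_ge0.
rewrite integral_axis_kernel -ge0_fin_numE ?hyperplane_average_fin_num//.
exact: hyperplane_average_ge0.
Qed.

Let G w := fine (plane_integral u s w).

Let mG : measurable_fun setT (EFin \o G).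
Proof.
apply/measurable_EFinP; apply: (measurableT_comp (fine_measurable measurableT)).
exact: (measurable_plane_integral_dir cu u0).
Qed.

Let G0 w : (0 <= (EFin \o G) w)%E.
Proof. by rewrite lee_fin; apply: fine_ge0; exact: plane_integral_ge0. Qed.

Lemma integral_plane_subsphere :
  (\int[great_subsphere_measure v]_(w in great_subsphere v) (G w)%:E =
   hyperplane_average E (EFin \o u) s)%E.
Proof.
rewrite (ge0_integral_great_subsphere v1 mG G0) vE.
apply: (eq_sphere_integral ltr01).
- apply: (measurableT_comp mG); apply: measurable_mulmx_rV;
  exact: measurable_id.
- by move=> x; exact: G0.
- exact: (measurableT_comp (measurable_plane_integral E mEu Eu0)
  (pair1_measurable s)).
- by move=> x; exact: integral_ge0.
- move=> x x1; rewrite /G /= fineK//; apply: (plane_integral_fin_num cu u0 uK).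
  by have [EE _] := wE; rewrite norm2_orthogonal.
Qed.

Lemma integrable_plane_subsphere :
  (great_subsphere_measure v).-integrable (great_subsphere v) (EFin \o G).
Proof.
apply/integrableP; split; first exact: measurable_funTS.
rewrite (_ : \int[_]_(r in _) _ =
    \int[great_subsphere_measure v]_(w in great_subsphere v) (G w)%:E)%E;
      last first.
  by apply: eq_integral => w _; rewrite gee0_abs.
rewrite integral_plane_subsphere -ge0_fin_numE ?hyperplane_average_fin_num//.
exact: hyperplane_average_ge0.
Qed.

End nonnegative_integrable.

(** Homogeneity of the sphere measure. With n = k.+2 the factor is r^(n-2), the link between the
    cylinder integral and A(r). *)
Lemma integral_sphere_axis (R : realType) k (v p : 'rV[R]_k.+2)
  (E : 'M[R]_(k.+1, k.+2))
    (g : 'rV[R]_k.+2 -> R) r :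
  0 < r -> measurable_fun setT g -> (forall x, 0 <= g x) ->
  (\int[@sphere_measure R k.+1 r]_x \int[lebesgue_measure]_t
      (g (p + t *: v + x *m E))%:E =
    (r ^+ k)%:E * sphere_axis_integral v E (EFin \o translate p g) r)%E.
Proof.
move=> r0 mg g0.
have mEg : measurable_fun setT (EFin \o translate p g).
  by apply: measurable_EFinT; exact: measurable_translate.
have Eg0 x : (0 <= (EFin \o translate p g) x)%E by rewrite lee_fin; exact: g0.
rewrite /sphere_axis_integral -(ge0_integral_sphere_scale r0
  (measurable_axis_integral v E mEg Eg0) (axis_integral_ge0 v E Eg0)).
apply: eq_integral => x _; apply: eq_integral => t _; congr (g _)%:E.
by rewrite -addrA addrC.
Qed.

(** * Compact support and Gaussian domination *)

Section compact_support.
Context {R : realType}.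

Lemma compact_support_bounded n (f : 'rV[R]_n -> R) : continuous f ->
  compact (supp f) ->
  exists2 M, 0 <= M & forall x, `|f x| <= M.
Proof.
move=> cf csupp.
have /(@compact_bounded R R^o)[M [_ MB]] : compact (f @` supp f).
  by apply: continuous_compact => //; exact: continuous_subspaceT.
have fM := MB (M + 1) (ltr_pwDr ltr01 (lexx M)). 
exists (Num.max (M + 1) 0) => [|x]; first by rewrite le_max lexx orbT.
have [->|fx] := eqVneq (f x) 0; first by rewrite normr0 le_max lexx orbT.
by rewrite le_max fM//; exists x => //; exact: subset_closure.
Qed.

(** Where the translate is nonzero, |x + p| < a and |p| = a, so |x| <= 2 a and e^(4 a^2) times the
    Gaussian is at least 1. *)
Lemma gauss_bound n (a : R) (f : 'rV[R]_n -> R) (p : 'rV[R]_n) :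
  continuous f -> compact (supp f) -> supp f `<=` eball n a -> norm2 p = a ->
  exists K, forall x, `|translate p f x| <= K * gauss x.
Proof.
move=> cf csupp fa pa; have [M M0 fM] := compact_support_bounded cf csupp.
exists (M * expR (4 * a ^+ 2)) => x; rewrite /translate.
have [->|fx] := eqVneq (f (x + p)) 0.
  by rewrite normr0 !mulr_ge0 ?expR_ge0 ?gauss_ge0.
have xp : norm2 (x + p) < a by apply: fa; exact: subset_closure.
rewrite (le_trans (fM _))// -mulrA ler_peMr// /gauss -expRD -[X in X <= _]expR0
  ler_expR subr_ge0.
have a0 : 0 <= a by rewrite -pa sqrtr_ge0.
have xp2 : dot (x + p) (x + p) <= a ^+ 2.
  rewrite -sqr_norm2; apply: lerXn2r; rewrite ?nnegrE//; last exact: ltW.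
  exact: sqrtr_ge0.
(* Parallelogram law: |x|^2 + |x + 2 p|^2 = 2 |x + p|^2 + 2 |p|^2 <= 4 a^2. *)
have := dot_ge0 (x + p + p).
have p2 : dot p p = a ^+ 2 by rewrite -sqr_norm2 pa.
move: xp2; rewrite !(dotDl, dotDr) p2 (dotC p x); lra.
Qed.

Lemma continuous_pos_part n (f : 'rV[R]_n -> R) : continuous f ->
  continuous (pos_part f).
Proof.
move=> cf x; apply: (@continuous_comp _ _ _ f (fun t : R => Num.max t 0));
  first exact: cf.
have -> : (fun t : R => Num.max t 0) = (fun t => (t + `|t|) / 2).
  by apply/funext => t; rewrite maxr_absE subr0 addr0.
apply: cvgM; last exact: cvg_cst.
by apply: cvgD; [exact: cvg_id|exact: norm_continuous].
Qed.

Lemma continuous_translate n (f : 'rV[R]_n.+1 -> R) p : continuous f ->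
  continuous (translate p f).
Proof.
move=> cf x; apply: (@continuous_comp _ _ _ (fun y : 'rV[R]_n.+1 => y + p) f);
  last exact: cf.
exact: (cvgD cvg_id (cvg_cst p)).
Qed.
End compact_support.

Theorem proposition3p1 (R : realType) (n : nat) (hn : (3 <= n)%N)
    (a : R) (ha : 0 < a)
    (f : 'rV[R]_n -> R) (hf : Cc_infty f) (hsupp : supp f `<=` eball n a)
    (v : 'rV[R]_n) (hv : esphere n 1 v)
    (p : 'rV[R]_n) (hp : esphere n a p)
    (s : R) (hs : 0 <= s) :
  (\int[lebesgue_measure]_(r in `]s, +oo[)
      (cylindrical_Radon f v p r * kernel_g n s r)%:E)%E =
    (sphere_delta_integral (fun w => Radon f w (s + dot w p)) v)%:E /\
  sphere_delta_integral (fun w => Radon f w (s + dot w p)) v =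
    Funk (Radon_at s (translate p f)) v.
Proof.
case: n hn f hf hsupp v hv p hp => [hn|[hn|[hn|k _ f [sf csupp] hsupp v hv p
  hp]]];
  [discriminate hn|discriminate hn|discriminate hn|].
have cf : continuous f by have [] := sf [::].
have mf := continuous_measurable_rV cf.
(* The second equality already holds between the integrands on the great subsphere, where w is a
   unit vector. *)
split; last first.
  apply: eq_Rintegral => w; rewrite inE => -[w1 _].
  exact: Radon_translate.
have [K uK] := gauss_bound cf csupp hsupp hp.
have cu := continuous_translate (p := p) cf.
set u := translate p f in uK cu.
have mtr : measurable_fun setT u by exact: continuous_measurable_rV.
have [E vE] : exists E, perp_frame v = E by eexists.
have wE : is_perp_frame v E by rewrite -vE; exact: perp_frameP.
have Kp x : pos_part u x <= K * gauss x.
  by rewrite ge_max (le_trans (ler_norm _) (uK x)) (le_trans (normr_ge0 _)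
    (uK x)).
have Kn x : pos_part (-%R \o u) x <= K * gauss x.
  rewrite ge_max (le_trans (normr_ge0 _) (uK x)) andbT (le_trans _ (uK x))//.
  by rewrite -normrN ler_norm.
have cp : continuous (pos_part u) by exact: continuous_pos_part.
have cn : continuous (pos_part (-%R \o u)).
  by apply: continuous_pos_part => x; exact: (cvgN (cu x)).
have p0 := pos_part_ge0 u; have n0 := pos_part_ge0 (-%R \o u).
have mfp : measurable_fun setT (pos_part f) by exact: measurable_pos_part.
have mfn : measurable_fun setT (pos_part (-%R \o f)).
  by apply: measurable_pos_part; exact: measurableT_comp.
pose A g r := fine (sphere_axis_integral v E (EFin \o g) r).
pose c r := r ^+ k.+1 * kernel_g k.+3 s r.
pose G (g : 'rV[R]_k.+3 -> R) w := fine (plane_integral g s w).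
have AE (g : 'rV[R]_k.+3 -> R) r : continuous g -> (forall x, 0 <= g x) ->
  (forall x, g x <= K * gauss x) ->
    sphere_axis_integral v E (EFin \o g) r = (A g r)%:E.
  by move=> cg g0 gK; rewrite fineK//; exact: (sphere_axis_integral_fin_num hv
    wE cg g0 gK).
(* Both parts of the cylinder integral are finite for r > s, so [fine] passes through their
   difference; the factor r^(k+1) from rescaling the sphere is collected in c. *)
have -> : (\int[lebesgue_measure]_(r in `]s, +oo[)
      (cylindrical_Radon f v p r * kernel_g k.+3 s r)%:E =
    \int[lebesgue_measure]_(r in `]s, +oo[)
      ((A (pos_part u) r * c r)%:E - (A (pos_part (-%R \o u)) r * c r)%:E))%E.
  apply: eq_integral => r; rewrite inE/= in_itv/= andbT => sr.
  have r0 := le_lt_trans hs sr.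
  rewrite (cylindrical_RadonE mf p r0 hv) vE.
  rewrite (integral_sphere_axis v p E r0 mfp (pos_part_ge0 f)).
  rewrite (integral_sphere_axis v p E r0 mfn (pos_part_ge0 (-%R \o f))).
  rewrite (AE _ r cp p0 Kp) (AE _ r cn n0 Kn) -!EFinM -!EFinB /=.
  by rewrite /c; congr EFin; ring.
rewrite integralB_EFin//; last 2 first.
- exact: (integrable_axis_kernel hv vE cp p0 Kp hs).
- exact: (integrable_axis_kernel hv vE cn n0 Kn hs).
rewrite (integral_axis_kernel hv vE cp p0 Kp hs) (integral_axis_kernel hv vE cn
  n0 Kn hs).
(* Translating by p moves the level s + w . p back to s, so the same [hyperplane_average] of each
   part appears on this side too. *)
have -> : sphere_delta_integral (fun w => Radon f w (s + dot w p)) v =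
    fine (\int[great_subsphere_measure v]_(w in great_subsphere v)
      ((G (pos_part u) w)%:E - (G (pos_part (-%R \o u)) w)%:E))%E.
  apply: eq_Rintegral => w; rewrite inE => -[w1 _].
  have GE (g : 'rV[R]_k.+3 -> R) : continuous g -> (forall x, 0 <= g x) ->
    (forall x, g x <= K * gauss x) ->
      plane_integral g s w = (G g w)%:E.
    by move=> cg g0 gK; rewrite fineK//; exact: (plane_integral_fin_num cg g0
      gK).
  rewrite (Radon_translate p s mf w1) (RadonE mtr s w1 (householderP w1)).
  by rewrite -/(plane_integral _ s w) (GE _ cp p0 Kp) -/(plane_integral _ s w)
    (GE _ cn n0 Kn).
rewrite integralB_EFin; first last.
- exact: (integrable_plane_subsphere hv vE s cn n0 Kn).
- exact: (integrable_plane_subsphere hv vE s cp p0 Kp).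
- exact: measurable_great_subsphere_set.
rewrite (integral_plane_subsphere hv vE s cp p0 Kp)
  (integral_plane_subsphere hv vE s cn n0 Kn).
rewrite fineK// fin_numB (hyperplane_average_fin_num hv vE s cp p0 Kp).
exact: (hyperplane_average_fin_num hv vE s cn n0 Kn).
Qed.
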